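(* For every non-negative and concave function $h\in L^\infty(0,1)$, not identically zero, the following inequalities hold: $$\frac{\pi^2}{12}\le F(h)\le 4,\qquad\text{where } F(h):=\frac{\mu_1(h)\int_0^1h(x)\,dx}{\sigma_1(h)}.$$
   Context: For a non-negative concave $h\in L^\infty(0,1)$, not identically zero, $\mu_1(h)$ is the first non-zero eigenvalue of $$-\frac{d}{dx}\Big(h\frac{du}{dx}\Big)=\mu\, h\,u\ \text{ on }(0,1),\qquad h(0)u'(0)=h(1)u'(1)=0,$$ and $\sigma_1(h)$ is the first non-zero eigenvalue of $$-\frac{d}{dx}\Big(h\frac{dv}{dx}\Big)=\sigma\, v\ \text{ on }(0,1),\qquad h(0)v'(0)=h(1)v'(1)=0.$$ These problems are understood in the weak sense ($h$ may vanish at the endpoints), and $$\mu_1(h)=\inf\Big\{\frac{\int_0^1(u')^2h}{\int_0^1u^2h}: 0\ne u\in H^1(0,1),\int_0^1uh=0\Big\},\quad \sigma_1(h)=\inf\Big\{\frac{\int_0^1(v')^2h}{\int_0^1v^2}: 0\ne v\in H^1(0,1),\int_0^1v=0\Big\}.$$ *)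

(* Defs.v *)
From mathcomp Require Import all_boot all_order all_algebra.
From mathcomp Require Import all_classical all_reals all_analysis.
Set Implicit Arguments.
Unset Strict Implicit.
Unset Printing Implicit Defensive.
Import Order.TTheory GRing.Theory Num.Theory.
Import numFieldNormedType.Exports.
Local Open Scope classical_set_scope.
Local Open Scope ring_scope.

Definition I01 (R : realType) : set R := `]0, 1[%classic.
Arguments I01 {R}.

(* Functions on (0,1) are represented by total functions R -> R; every notion
   below depends only on their values on (0,1). *)

Definition L_on01 (R : realType) (p : \bar R) (f : R -> R) : Prop :=
  f \_ I01 \in Lfun (@lebesgue_measure R) p.

Definition concave_on01 (R : realType) (h : R -> R) : Prop :=
  convex_function (I01 : set R^o) (fun x => - h x).

Definition integral01 (R : realType) (f : R -> R) : R :=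
  \int[@lebesgue_measure R]_(x in I01) f x.

(* C^1_c(0,1): the closure of the support is bounded, so that asking for it to
   lie in (0,1) makes it compact. *)
Definition test_function (R : realType) (phi : R -> R) : Prop :=
  [/\ forall x, derivable phi x 1,
      continuous (derive1 phi) &
      closure [set x | phi x != 0] `<=` I01].

Definition weak_derivative (R : realType) (u du : R -> R) : Prop :=
  forall phi : R -> R, test_function phi ->
    integral01 (fun x => u x * derive1 phi x) = - integral01 (fun x => du x * phi x).

(* u is in H^1(0,1) with weak derivative du.  Testing against C^1_c or against
   C^oo_c functions gives the same space, by mollification. *)
Definition H1_pair (R : realType) (u du : R -> R) : Prop :=
  [/\ L_on01 2%:E u, L_on01 2%:E du & weak_derivative u du].

(* u is not the zero element of H^1(0,1), whose elements are classes modulo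
   equality almost everywhere. *)
Definition nonzero01 (R : realType) (u : R -> R) : Prop :=
  ~ {ae @lebesgue_measure R, forall x, I01 x -> u x = 0}.

(* First non-zero eigenvalue of - (h u')' = mu h u with h u' = 0 at 0 and 1, given
   by its Rayleigh quotient (0 is the eigenvalue with constant eigenfunctions).
   The set is a non-empty set of non-negative reals, so inf is the infimum;
   the denominators are positive for h as in the theorem. *)
Definition mu1 (R : realType) (h : R -> R) : R :=
  inf [set q | exists u du : R -> R,
    [/\ H1_pair u du, nonzero01 u, integral01 (fun x => u x * h x) = 0 &
        q = integral01 (fun x => du x ^+ 2 * h x) /
            integral01 (fun x => u x ^+ 2 * h x)]].

(* The same for - (h v')' = sigma v with h v' = 0 at 0 and 1. *)
Definition sigma1 (R : realType) (h : R -> R) : R :=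
  inf [set q | exists v dv : R -> R,
    [/\ H1_pair v dv, nonzero01 v, integral01 v = 0 &
        q = integral01 (fun x => dv x ^+ 2 * h x) /
            integral01 (fun x => v x ^+ 2)]].

Definition F (R : realType) (h : R -> R) : R :=
  mu1 h * integral01 h / sigma1 h.

(* Main.v *)
Require Import Defs.
From mathcomp Require Import all_boot all_order all_algebra.
From mathcomp Require Import all_classical all_reals all_analysis.
From mathcomp Require Import measurable_realfun ring lra.
Set Implicit Arguments.
Unset Strict Implicit.
Unset Printing Implicit Defensive.
Import Order.TTheory GRing.Theory Num.Theory.
Import numFieldNormedType.Exports.
Local Open Scope classical_set_scope.
Local Open Scope ring_scope.

(** Write A for the integral of h, c for its center of mass, V for the integral
    of (x - c)^2 h, and q = c (1 - c).

    For the lower bound, x - 1/2 is admissible for sigma_1 and gives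
    sigma_1 <= 12 A ([sigma1_le_integral]), while the Payne-Weinberger inequality
    gives mu_1 >= pi^2 ([mu1_ge_pi2]).

    For the upper bound, x - c is admissible for mu_1 and gives mu_1 <= A / V
    ([mu1_le_variance]), and it remains to see that A^2 / V <= 4 sigma_1.  Both
    sides are compared with h(c):
    - a concave h lies above the tent of height h(c) with peak at c, and the
      first eigenvalue of a tent is estimated by a cubic supersolution, so that
      sigma_1 >= h(c) / (4 q (1 - 3 q)) ([sigma1_ge]);
    - a concave h lies between that tent and a supporting line at c, and among
      all functions between them with integral A a bathtub argument bounds the
      second moment from below: A^2 q (1 - 3 q) <= h(c) V
      ([sqr_integral_le_second_moment]).
    The two estimates combine exactly to A^2 / V <= 4 sigma_1.  They use
    1/3 <= c <= 2/3, which holds for the center of mass of a concave function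
    ([mean_mem_third]).

    The lower bounds for the eigenvalues concern all u in H^1, which is known
    only through integration against test functions.  They are therefore proved
    in dual form.  If k is the weight of the denominator of the Rayleigh quotient
    and
        B int psi^2 / h <= int psi'^2 / k   for every test function psi,
    then B int u^2 k <= int u'^2 h for every u in H^1 with int u k = 0, because
    psi' runs through a dense set of functions with mean zero and so may
    approximate u k ([poincare_of_hardy]).  The inequality for test functions
    follows from a solution Phi of the Riccati inequality
        - Phi' >= k Phi^2 + B / h
    by completing a square ([hardy_itv_of_riccati]); such a Phi is w' / (w k)
    for a positive supersolution w.  For sigma_1, w is a cubic polynomial.  For
    mu_1, w = sqrt(h) sin (pi x), which requires h to be twice differentiable;
    a general h is replaced by an iterated average, which is again concave and
    uniformly close to h in relative terms ([concave_smoothing]). *)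

(** * Integration over (0,1) *)

Definition integrable01 (R : realType) (f : R -> R) : Prop :=
  (@lebesgue_measure R).-integrable I01 (EFin \o f).

Definition sq_integrable01 (R : realType) (f : R -> R) : Prop :=
  measurable_fun (I01 : set R) f /\ integrable01 (fun x => f x ^+ 2).

Section Integration01.
Context {R : realType}.
Implicit Types f g u v : R -> R.
Local Notation mu := (@lebesgue_measure R).

Lemma measurable_I01 : measurable (I01 : set R).
Proof. by rewrite /I01; exact: measurable_itv. Qed.
Hint Resolve measurable_I01 : core.

Lemma mu_I01 : mu (I01 : set R) = 1%E.
Proof. by rewrite /I01 lebesgue_measure_itv /= lte_fin ltr01 oppr0 adde0. Qed.

Lemma in_I01 (x : R) : I01 x <-> 0 < x < 1.
Proof. by rewrite /I01 /= in_itv. Qed.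

Lemma integral01D f g : integrable01 f -> integrable01 g ->
  integral01 (fun x => f x + g x) = integral01 f + integral01 g.
Proof. exact: RintegralD. Qed.

Lemma integral01B f g : integrable01 f -> integrable01 g ->
  integral01 (fun x => f x - g x) = integral01 f - integral01 g.
Proof. exact: RintegralB. Qed.

Lemma integral01Z c f : integrable01 f ->
  integral01 (fun x => c * f x) = c * integral01 f.
Proof. exact: RintegralZl. Qed.

Lemma integral01_ge0 f : (forall x, 0 < x < 1 -> 0 <= f x) -> 0 <= integral01 f.
Proof. by move=> f0; apply: Rintegral_ge0 => x /in_I01; exact: f0. Qed.

Lemma le_integral01 f g : integrable01 f -> integrable01 g ->
  (forall x, 0 < x < 1 -> f x <= g x) -> integral01 f <= integral01 g.
Proof.
by move=> f1 g1 fg; apply: le_Rintegral => // x /in_I01; exact: fg.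
Qed.

Lemma eq_integral01 f g : (forall x, 0 < x < 1 -> f x = g x) ->
  integral01 f = integral01 g.
Proof.
by move=> fg; apply: eq_Rintegral => x; rewrite inE => /in_I01; exact: fg.
Qed.

Lemma integral01_cst (c : R) : integral01 (fun=> c) = c.
Proof.
rewrite /integral01 Rintegral_cst// (_ : fine _ = 1) ?mulr1//.
exact: (congr1 fine mu_I01).
Qed.

Lemma integrable01D f g : integrable01 f -> integrable01 g ->
  integrable01 (fun x => f x + g x).
Proof. by move=> f1 g1; exact: integrableD f1 g1. Qed.

Lemma integrable01N f : integrable01 f -> integrable01 (fun x => - f x).
Proof. by move=> f1; exact: integrableN f1. Qed.

Lemma integrable01B f g : integrable01 f -> integrable01 g ->
  integrable01 (fun x => f x - g x).
Proof. by move=> f1 /integrable01N g1; exact: integrable01D. Qed.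

Lemma integrable01Z c f : integrable01 f -> integrable01 (fun x => c * f x).
Proof. by move=> f1; apply: (integrableZl (mu:=mu) _ c f1). Qed.

Lemma eq_integrable01 f g : (forall x, 0 < x < 1 -> f x = g x) ->
  integrable01 f -> integrable01 g.
Proof.
move=> fg; apply: eq_integrable => // x; rewrite inE => /in_I01 x01.
by rewrite /= fg.
Qed.

Lemma measurable_integrable01 f : integrable01 f -> measurable_fun (I01 : set R) f.
Proof. by move=> /measurable_int/measurable_EFinP. Qed.

Lemma le_integrable01 f g : measurable_fun (I01 : set R) f ->
  (forall x, 0 < x < 1 -> `|f x| <= g x) -> integrable01 g -> integrable01 f.
Proof.
move=> mf fg; apply: le_integrable => //; first exact/measurable_EFinP.
move=> x /in_I01 /fg fgx; rewrite /= lee_fin (le_trans fgx)//.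
exact: ler_norm.
Qed.

Lemma integrable01_cst (c : R) : integrable01 (fun=> c).
Proof.
apply: measurable_bounded_integrable => //=; first by rewrite mu_I01 ltry.
exists `|c|; split; rewrite ?num_real//.
by move=> x cx y _; rewrite ltW.
Qed.

Lemma bounded_integrable01 f (M : R) : measurable_fun (I01 : set R) f ->
  (forall x, 0 < x < 1 -> `|f x| <= M) -> integrable01 f.
Proof. by move=> mf fM; apply: le_integrable01 (integrable01_cst M). Qed.

Lemma continuous_measurable01 f : (forall x, 0 < x < 1 -> {for x, continuous f}) ->
  measurable_fun (I01 : set R) f.
Proof.
move=> cf; apply: open_continuous_measurable_fun.
  by rewrite /I01; exact: interval_open.
by move=> x; rewrite inE => /in_I01; exact: cf.
Qed.

Lemma continuous_integrable01 f : continuous f -> integrable01 f.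
Proof.
move=> cf; apply: (@integrableS _ _ _ mu `[0, 1]) => //.
- exact: subset_itv_oo_cc.
- apply: continuous_compact_integrable; first exact: segment_compact.
  exact: continuous_subspaceT.
Qed.

(** The derivative is required at the end points as well, which spares the
    one-sided continuity conditions: the antiderivatives used below are
    differentiable in a neighborhood of the interval. *)
Lemma FTC_itv f (F : R -> R) (a b : R) : a <= b ->
  {within `[a, b], continuous f} ->
  (forall x, a <= x <= b -> is_derive x 1 F (f x)) ->
  \int[mu]_(x in `[a, b]) f x = F b - F a.
Proof.
rewrite le_eqVlt => /orP[/eqP <- _ _|ab cf dF].
  by rewrite set_itv1 Rintegral_set1 subrr.
rewrite /Rintegral (@continuous_FTC2 _ f F)//.
- have cF x : a <= x <= b -> {for x, continuous F}.
    by move=> /dF dFx; apply/differentiable_continuous/derivable1_diffP.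
  split.
  + move=> x; rewrite in_itv /= => /andP[ax xb].
    by have /dF[] : a <= x <= b by lra.
  + by apply: cvg_at_right_filter; apply: cF; lra.
  + by apply: cvg_at_left_filter; apply: cF; lra.
- move=> x; rewrite in_itv /= => /andP[ax xb].
  by rewrite derive1E; apply: derive_val; apply: dF; lra.
Qed.

Lemma FTC01 f (F : R -> R) : continuous f ->
  (forall x : R, is_derive x 1 F (f x)) -> integral01 f = F 1 - F 0.
Proof.
move=> cf dF; rewrite -(@FTC_itv f)//; last exact: continuous_subspaceT.
have i1 : mu.-integrable `[0, 1] (EFin \o f).
  apply: continuous_compact_integrable; first exact: segment_compact.
  exact: continuous_subspaceT.
rewrite /integral01 /I01 Rintegral_itv_bndo_bndc.
  rewrite Rintegral_itv_obnd_cbnd//.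
  by apply: integrableS i1 => //; exact: subset_itv_oc_cc.
by apply: integrableS i1 => //; exact: subset_itv_oo_cc.
Qed.

Lemma integrable01_mul f g : sq_integrable01 f -> sq_integrable01 g ->
  integrable01 (fun x => f x * g x).
Proof.
move=> [mf f2] [mg g2]; apply: le_integrable01 (integrable01D f2 g2).
  exact: measurable_funM.
by move=> x _ /=; rewrite ler_norml; nra.
Qed.

Lemma sq_integrable01D f g : sq_integrable01 f -> sq_integrable01 g ->
  sq_integrable01 (fun x => f x + g x).
Proof.
move=> fL gL; have [mf f2] := fL; have [mg g2] := gL; split.
  exact: measurable_funD.
apply: eq_integrable01
  (integrable01D f2 (integrable01D (integrable01Z 2 (integrable01_mul fL gL)) g2)).
by move=> x _ /=; ring.
Qed.

Lemma sq_integrable01M f g (M : R) : measurable_fun (I01 : set R) g ->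
  (forall x, 0 < x < 1 -> `|g x| <= M) -> sq_integrable01 f ->
  sq_integrable01 (fun x => g x * f x).
Proof.
move=> mg gM [mf f2]; split; first exact: measurable_funM.
apply: le_integrable01 (integrable01Z (M ^+ 2) f2).
  by apply: measurable_funX; exact: measurable_funM.
move=> x /gM gx; rewrite ger0_norm ?sqr_ge0// exprMn ler_wpM2r ?sqr_ge0//.
by rewrite -(real_normK (num_real (g x))) ler_sqr ?nnegrE// (le_trans _ gx).
Qed.

Lemma bounded_sq_integrable01 f (M : R) : measurable_fun (I01 : set R) f ->
  (forall x, 0 < x < 1 -> `|f x| <= M) -> sq_integrable01 f.
Proof.
move=> mf fM; split => //.
apply: (@bounded_integrable01 _ (M ^+ 2)); first exact: measurable_funX.
move=> x /fM fx; rewrite normrX ler_sqr ?nnegrE// (le_trans _ fx)//.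
Qed.

Lemma L_on01_sq_integrable u : L_on01 2%:E u -> sq_integrable01 u.
Proof.
move=> uL; split.
  have /andP[+ _] := uL; rewrite inE /= => um.
  by have /(measurable_restrictT u measurable_I01) := um.
have := Lfun2_integrable_sqr uL.
rewrite /integrable01 [X in _ -> X]integrable_mkcond//.
congr (_.-integrable _ _); apply/funext => x /=.
by rewrite !patchE; case: ifP => //=; rewrite expr0n.
Qed.

Lemma sq_integrable01_L_on01 u : sq_integrable01 u -> L_on01 2%:E u.
Proof.
move=> [um /integrableP[_ u2]]; rewrite /L_on01 inE; apply/andP; split.
  by rewrite inE /=; apply/(measurable_restrictT u measurable_I01).
rewrite inE /= /finite_norm unlock; apply: poweR_lty.
rewrite integral_mkcond in u2; apply: le_lt_trans u2.
rewrite le_eqVlt; apply/orP; left; apply/eqP; apply: eq_integral => x _.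
rewrite /= !patchE; case: ifP => _ /=.
  by rewrite powR_mulrn// normrX.
by rewrite normr0 powR0.
Qed.

(** The denominators of the Rayleigh quotients are positive by this fact. *)
Lemma integral01_gt0 f : integrable01 f -> (forall x, 0 < x < 1 -> 0 <= f x) ->
  nonzero01 f -> 0 < integral01 f.
Proof.
move=> f1 f0 fn0; rewrite lt_neqAle integral01_ge0// andbT eq_sym.
apply/eqP => If0; apply: fn0.
have mf : measurable_fun I01 (EFin \o f) by exact: measurable_int f1.
have mI : measurable (I01 : set R) := measurable_I01.
have /(ae_eq_integral_abs mu mI mf) : (\int[mu]_(x in I01) `|(EFin \o f) x| = 0)%E.
  transitivity (\int[mu]_(x in I01) (f x)%:E)%E.
    by apply: eq_integral => x; rewrite inE => /in_I01 x01; rewrite /= ger0_norm// f0.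
  rewrite -[LHS]fineK; last exact: integrable_fin_num.
  by congr EFin.
by apply: filterS => x /= H /H [].
Qed.

Lemma integral01_pos f : integrable01 f -> (forall x, 0 < x < 1 -> 0 < f x) ->
  0 < integral01 f.
Proof.
move=> f1 f0; apply: integral01_gt0 => //; first by move=> x /f0 /ltW.
move=> ae0; have /negligibleP : mu.-negligible (I01 : set R).
  apply: negligibleS ae0 => x /in_I01 x01 /= /(_ ((in_I01 x).2 x01)) fx.
  by have := f0 x x01; rewrite fx ltxx.
move=> /(_ measurable_I01) m0.
by have := mu_I01; rewrite -[LHS]/(mu _) [X in X = _ -> _]m0 => -[]; lra.
Qed.

End Integration01.

(** * Test functions and Rayleigh quotients *)

Section Rayleigh.
Context {R : realType}.
Implicit Types f g u v h k : R -> R.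
Local Notation mu := (@lebesgue_measure R).

Lemma is_derive_continuous f (x df : R) : is_derive x 1 f df -> {for x, continuous f}.
Proof. by move=> ?; apply/differentiable_continuous/derivable1_diffP. Qed.

Lemma test_function_end0 phi : test_function phi -> phi 0 = 0 /\ phi 1 = 0 :> R.
Proof.
move=> [_ _ sub]; split; apply: contrapT => /eqP n0.
  have := sub 0 (@subset_closure _ [set x | phi x != 0] 0 n0).
  by rewrite in_I01 ltxx.
have := sub 1 (@subset_closure _ [set x | phi x != 0] 1 n0).
by rewrite in_I01 ltxx andbF.
Qed.

Lemma test_function_is_derive phi (x : R) : test_function phi ->
  is_derive x 1 phi (derive1 phi x).
Proof. by move=> [dphi _ _]; rewrite derive1E; exact: derivableP. Qed.

Lemma test_function_continuous phi : test_function phi -> continuous (phi : R -> R).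
Proof.
by move=> tphi x; exact: is_derive_continuous (test_function_is_derive x tphi).
Qed.

Lemma H1_pair_affine (c : R) : H1_pair (fun x => x - c) (fun=> 1).
Proof.
have cx : continuous (fun x : R => x - c).
  by move=> x; apply: cvgB; [exact: cvg_id|exact: cvg_cst].
split.
- apply: sq_integrable01_L_on01.
  apply: (@bounded_sq_integrable01 _ _ (1 + `|c|)).
    by apply: continuous_measurable01 => x _; exact: cx.
  by move=> x x01; rewrite (le_trans (ler_normB _ _))// lerD2r ger0_norm; lra.
- apply: sq_integrable01_L_on01; apply: (@bounded_sq_integrable01 _ _ 1) => //.
  by move=> x _; rewrite normr1.
- move=> phi tphi; have [phi0 phi1] := test_function_end0 tphi.
  have [_ cphi' _] := tphi; have cphi := test_function_continuous tphi.
  have i1 : integrable01 (fun x => (x - c) * derive1 phi x).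
    by apply: continuous_integrable01 => x; apply: cvgM; [exact: cx|exact: cphi'].
  have i2 : integrable01 (fun x => 1 * phi x).
    by apply: continuous_integrable01 => x; apply: cvgM; [exact: cvg_cst|exact: cphi].
  apply/eqP; rewrite -subr_eq0 opprK -integral01D//.
  have cF : continuous (fun x : R => (x - c) * derive1 phi x + 1 * phi x).
    by move=> x; apply: cvgD; apply: cvgM;
      [exact: cx|exact: cphi'|exact: cvg_cst|exact: cphi].
  have dF (x : R) : is_derive x 1 (fun y : R => (y - c) * phi y)
      ((x - c) * derive1 phi x + 1 * phi x).
    have dphi := test_function_is_derive x tphi.
    by apply: is_derive_eq; rewrite /GRing.scale /=; ring.
  by rewrite (FTC01 cF dF) phi0 phi1 !mulr0 subrr.
Qed.

(** Both eigenvalues are of this form, with k = h for mu_1 and k = 1 for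
    sigma_1. *)
Definition rayleigh_inf h k : R :=
  inf [set q | exists u du : R -> R,
    [/\ H1_pair u du, nonzero01 u, integral01 (fun x => u x * k x) = 0 &
        q = integral01 (fun x => du x ^+ 2 * h x) /
            integral01 (fun x => u x ^+ 2 * k x)]].

Lemma sigma1E h : sigma1 h = rayleigh_inf h (fun=> 1).
Proof.
rewrite /sigma1 /rayleigh_inf; congr inf; apply/seteqP.
split => q /= [u [du [uH un0 u0 ->]]]; exists u, du; split => //.
- by rewrite -u0; apply: eq_integral01 => x _; rewrite mulr1.
- by congr (_ / _); apply: eq_integral01 => x _; rewrite mulr1.
- by rewrite -u0; apply: eq_integral01 => x _; rewrite mulr1.
- by congr (_ / _); apply: eq_integral01 => x _; rewrite mulr1.
Qed.

Lemma integral01_sqr_affine (c : R) :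
  integral01 (fun x => (x - c) ^+ 2) = ((1 - c) ^+ 3 + c ^+ 3) / 3.
Proof.
have cF : continuous (fun x : R => (x - c) ^+ 2).
  move=> x; apply: (@continuous_comp _ _ _ (fun y : R => y - c) (fun y => y ^+ 2)).
    by apply: cvgB; [exact: cvg_id|exact: cvg_cst].
  exact: exprn_continuous.
have dF (x : R) : is_derive x 1 (fun y : R => (y - c) ^+ 3 / 3) ((x - c) ^+ 2).
  by apply: is_derive_eq; rewrite /GRing.scale /=; field.
by rewrite (FTC01 cF dF); field.
Qed.

Lemma nonzero01_affine (c : R) : nonzero01 (fun x => x - c).
Proof.
move=> ae0; have /eqP := integral01_sqr_affine c.
rewrite (_ : integral01 _ = 0); last first.
  transitivity (integral01 (fun _ : R => 0 : R)); last exact: integral01_cst.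
  congr fine; apply: ae_eq_integral; first exact: measurable_I01.
  - apply/measurable_EFinP; apply: measurable_funX.
    by apply: continuous_measurable01 => x _; apply: cvgB; [exact: cvg_id|exact: cvg_cst].
  - exact: measurable_cst.
  - move: ae0; apply: filterS; first exact: (ae_filter_ringOfSetsType mu).
    by move=> x /= + xI => /(_ xI) ->; rewrite expr0n.
rewrite eq_sym mulf_eq0 invr_eq0 pnatr_eq0 orbF => /eqP c3.
have := sqr_ge0 (c - 1 / 2); nra.
Qed.

(** The affine function with the right mean is an admissible competitor; its
    derivative is 1, so the numerator is the integral of h. *)
Lemma rayleigh_inf_le h k (c : R) :
  (forall x, 0 < x < 1 -> 0 <= h x) -> (forall x, 0 < x < 1 -> 0 <= k x) ->
  integral01 (fun x => (x - c) * k x) = 0 ->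
  rayleigh_inf h k <= integral01 h / integral01 (fun x => (x - c) ^+ 2 * k x).
Proof.
move=> h0 k0 c0; apply: ge_inf.
  exists 0 => q /= [u [du [_ _ _ ->]]].
  by apply: divr_ge0; apply: integral01_ge0 => x x01;
    rewrite mulr_ge0 ?sqr_ge0 ?h0 ?k0.
exists (fun x => x - c), (fun=> 1); split => //.
- exact: H1_pair_affine.
- exact: nonzero01_affine.
- by congr (_ / _); apply: eq_integral01 => x _; rewrite expr1n mul1r.
Qed.

(** A Poincare inequality bounds the infimum from below.  The hypothesis on c
    serves to exhibit a competitor: the infimum of an empty set would be 0. *)
Lemma rayleigh_inf_ge h k (B M c : R) :
  (forall x, 0 < x < 1 -> 0 < k x <= M) -> measurable_fun (I01 : set R) k ->
  integral01 (fun x => (x - c) * k x) = 0 ->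
  (forall u du, H1_pair u du -> integral01 (fun x => u x * k x) = 0 ->
     B * integral01 (fun x => u x ^+ 2 * k x) <= integral01 (fun x => du x ^+ 2 * h x)) ->
  B <= rayleigh_inf h k.
Proof.
move=> k0 mk c0 poincare; apply: lb_le_inf.
  exists (integral01 (fun x => 1 ^+ 2 * h x) /
          integral01 (fun x => (x - c) ^+ 2 * k x)).
  exists (fun x => x - c), (fun=> 1); split => //.
  - exact: H1_pair_affine.
  - exact: nonzero01_affine.
move=> _ [u [du [uH un0 u0 ->]]]; rewrite ler_pdivlMr ?poincare//.
have [um u2] : sq_integrable01 u by apply: L_on01_sq_integrable; case: uH.
apply: integral01_gt0.
- apply: (le_integrable01 _ _ (integrable01Z M u2)).
    by apply: measurable_funM => //; exact: measurable_funX.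
  move=> x /k0 /andP[kx0 kxM]; have u0x := sqr_ge0 (u x).
  by rewrite ger0_norm; nra.
- by move=> x /k0 /andP[kx0 _]; rewrite mulr_ge0 ?sqr_ge0 ?(ltW kx0).
- move=> uk0; apply: un0; move: uk0.
  apply: filterS; first exact: (ae_filter_ringOfSetsType mu).
  move=> x /= + xI => /(_ xI) /eqP.
  have /andP[kx0 _] := k0 x ((in_I01 x).1 xI).
  by rewrite mulf_eq0 sqrf_eq0 (gt_eqF kx0) orbF => /eqP.
Qed.

End Rayleigh.

(** * Density of compactly supported continuous functions in L^2(0,1) *)

Section Density.
Context {R : realType}.
Implicit Types f g u v h k : R -> R.
Local Notation mu := (@lebesgue_measure R).

(** Dominated convergence for sequences that are eventually zero at each point,
    as truncations and cut-offs are. *)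
Lemma dominated_integral01_small (f_ : nat -> R -> R) (G : R -> R) (e : R) :
  (forall n, measurable_fun (I01 : set R) (f_ n)) -> integrable01 G ->
  (forall n x, 0 < x < 1 -> `|f_ n x| <= G x) ->
  (forall x, 0 < x < 1 -> \forall n \near \oo, f_ n x = 0) ->
  0 < e -> exists n, integral01 (f_ n) < e.
Proof.
move=> mf iG fG f0 e0.
have mfE n : measurable_fun (I01 : set R) (EFin \o f_ n) by exact/measurable_EFinP.
have f0E : {ae mu, forall x, I01 x -> (EFin \o f_ n) x @[n --> \oo] --> 0%E}.
  apply: aeW => x /in_I01 x01.
  apply: cvg_near_cst; near=> n; congr EFin; near: n; exact: f0.
have fGE : {ae mu, forall x n, I01 x -> (`|(EFin \o f_ n) x| <= (EFin \o G) x)%E}.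
  by apply: aeW => x n /in_I01 x01; rewrite /= lee_fin fG.
have [_ _] := @dominated_convergence _ _ _ mu I01 measurable_I01 (fun n => EFin \o f_ n) (cst 0%E)
  _ mfE (measurable_cst _) f0E iG fGE.
rewrite integral0 => cv0.
have /fine_cvg : (\int[mu]_(x in I01) (f_ n x)%:E)%E @[n --> \oo] --> 0%:E by [].
move=> /cvgrPdist_lt /(_ e e0) [n _ /(_ n (leqnn n))] /= h.
exists n; rewrite (le_lt_trans _ h)// sub0r normrN.
exact: ler_norm.
Unshelve. all: by end_near. Qed.

Definition clamp (M y : R) : R := Num.max (- M) (Num.min M y).

Lemma clamp_continuous M : continuous (clamp M).
Proof.
move=> y; apply: (@continuous_max _ _ (cst (- M)) (cst M \min id)).
  exact: cvg_cst.
by apply: (@continuous_min _ _ (cst M) id); [exact: cvg_cst|exact: cvg_id].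
Qed.

Lemma clamp_bound M y : 0 <= M -> `|clamp M y| <= M.
Proof.
by move=> M0; rewrite /clamp ler_norml le_max lexx ge_max ge_min lexx /=; lra.
Qed.

Lemma clamp_id M y : `|y| <= M -> clamp M y = y.
Proof.
by rewrite /clamp ler_norml => /andP[yM My]; rewrite min_r// max_r.
Qed.

Lemma clamp_dist M x y : 0 <= M -> `|clamp M x - clamp M y| <= `|x - y|.
Proof.
move=> M0; rewrite /clamp !maxEle !minEle; have := ler_norm (x - y).
have := ler_norm (y - x); rewrite (distrC y) ler_norml => ? ?.
by case: (leP M x) => ?; case: (leP M y) => ?; case: (leP (- M) M) => ?;
  case: (leP (- M) x) => ?; case: (leP (- M) y) => ?; apply/andP; split; lra.
Qed.

(** Truncation errors of u are dominated by u, hence square integrable. *)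
Lemma clamp_defect M y : 0 <= M -> `|y - clamp M y| <= `|y|.
Proof.
move=> M0; rewrite /clamp !maxEle !minEle; have := ler_norm y.
have := ler_norm (- y); rewrite normrN ler_norml => ? ?.
by case: (leP M y) => ?; case: (leP (- M) M) => ?; case: (leP (- M) y) => ?;
  apply/andP; split; lra.
Qed.

(** A trapezoid vanishing outside [d, 1 - d] and equal to 1 on [2 d, 1 - 2 d]. *)
Definition cutoff (d x : R) : R :=
  Num.max 0 (Num.min 1 (Num.min (x / d - 1) ((1 - x) / d - 1))).

Lemma cutoff_continuous d : continuous (cutoff d).
Proof.
pose f y : R := y / d - 1; pose g y : R := (1 - y) / d - 1.
move=> x; apply: (@continuous_max _ _ (cst 0) (cst 1 \min (f \min g))).
  exact: cvg_cst.
apply: (@continuous_min _ _ (cst 1) (f \min g)); first exact: cvg_cst.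
apply: (@continuous_min _ _ f g).
  by apply: cvgB; [apply: cvgM; [exact: cvg_id|exact: cvg_cst]|exact: cvg_cst].
apply: cvgB; last exact: cvg_cst.
apply: cvgM; last exact: cvg_cst.
by apply: cvgB; [exact: cvg_cst|exact: cvg_id].
Qed.

Lemma cutoff_ge0_le1 d x : 0 <= cutoff d x <= 1.
Proof.
by rewrite /cutoff le_max lexx ge_max ler01 ge_min lexx.
Qed.

Lemma cutoff_out d x : 0 < d -> ~~ (d <= x <= 1 - d) -> cutoff d x = 0.
Proof.
move=> d0 xd; apply/eqP; rewrite eq_le; have /andP[-> _] := cutoff_ge0_le1 d x.
rewrite andbT /cutoff ge_max lexx /= ge_min; apply/orP; right.
rewrite ge_min !subr_le0 !ler_pdivrMr// !mul1r.
by move: xd; rewrite negb_and -!ltNge => /orP[] ?; apply/orP; [left|right]; lra.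
Qed.

Lemma cutoff_in d x : 0 < d -> d *+ 2 <= x <= 1 - d *+ 2 -> cutoff d x = 1.
Proof.
move=> d0 xd; apply/eqP; rewrite eq_le; have /andP[_ ->] := cutoff_ge0_le1 d x.
rewrite /= /cutoff le_max; apply/orP; right.
rewrite !le_min lexx /= !lerBrDr !ler_pdivlMr//.
by move: xd; rewrite mulr2n; lra.
Qed.

Definition supported (d : R) (f : R -> R) : Prop :=
  forall x, ~~ (d <= x <= 1 - d) -> f x = 0.

(** Continuous functions are dense in L^1, but L^2 is needed here.  For functions
    bounded by N the squared L^2 distance is at most 2 N times the L^1 distance,
    so u is truncated, approximated in L^1 by a continuous function that is
    truncated at the same height, and multiplied by a cut-off. *)
Lemma dense_compact_support u (e : R) : sq_integrable01 u -> 0 < e ->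
  exists g d, [/\ continuous g, 0 < d < 2^-1, supported d g &
    integral01 (fun x => (u x - g x) ^+ 2) < e].
Proof.
move=> uL e0; have [um u2] := uL.
have e90 : 0 < e / 9 by rewrite divr_gt0.
have mclamp M f : measurable_fun (I01 : set R) f ->
    measurable_fun (I01 : set R) (fun x => clamp M (f x)).
  move=> mf; apply: measurable_maxr; first exact: measurable_cst.
  by apply: measurable_minr => //; exact: measurable_cst.
(* Each of the three approximations costs e / 9, since (a + b + c)^2 is at most
   3 (a^2 + b^2 + c^2). *)
have [N uN] : exists n : nat,
    integral01 (fun x => (u x - clamp n%:R (u x)) ^+ 2) < e / 9.
  apply: (dominated_integral01_small
    (f_ := fun n x => (u x - clamp n%:R (u x)) ^+ 2) _ u2) => //.
  - move=> n; apply: measurable_funX; apply: measurable_funB => //; exact: mclamp.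
  - move=> n x _; rewrite ger0_norm ?sqr_ge0//.
    rewrite -[leLHS]real_normK ?num_real// -[leRHS]real_normK ?num_real//.
    by rewrite ler_sqr ?nnegrE// clamp_defect.
  - move=> x _; near=> n; rewrite clamp_id ?subrr ?expr0n//.
    by near: n; exact: nbhs_infty_ger.
set w := fun x => clamp N%:R (u x).
have N0 : 0 <= N%:R :> R by exact: ler0n.
have iw : integrable01 w.
  apply: (@bounded_integrable01 _ _ N%:R); first exact: mclamp.
  by move=> x _; exact: clamp_bound.
have I01y : (mu I01 < +oo)%E by rewrite mu_I01 ltry.
have [g_ [cg ig gw]] := approximation_continuous_integrable measurable_I01 I01y iw.
have N10 : 0 < N%:R + 1 :> R by lra.
have e40 : 0 < e / 9 / (N%:R + 1) ^+ 2 / 4 by rewrite !divr_gt0// exprn_gt0.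
have [n wgn] : exists n, integral01 (fun x => `|w x - g_ n x|) < e / 9 / (N%:R + 1) ^+ 2 / 4.
  have /fine_cvg : (\int[mu]_(x in I01) `|(w x - g_ n x)%:E|)%E @[n --> \oo] --> 0%:E.
    exact: gw.
  move=> /cvgrPdist_lt /(_ _ e40) [n _ /(_ n (leqnn n))] /= wn.
  exists n; rewrite (le_lt_trans _ wn)// sub0r normrN.
  by rewrite (le_trans _ (ler_norm _)).
pose g0 x := clamp N%:R (g_ n x).
have cg0 : continuous g0.
  move=> x; apply: (@continuous_comp _ _ _ (g_ n) (clamp N%:R)); first exact: cg.
  exact: clamp_continuous.
have mg0 : measurable_fun (I01 : set R) g0.
  by apply: continuous_measurable01 => x _; exact: cg0.
have mw : measurable_fun (I01 : set R) w by exact: mclamp.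
have iwg : integrable01 (fun x => `|w x - g_ n x|).
  by apply: integrable_norm; apply: integrable01B => //; exact: ig.
have wg0 : integral01 (fun x => (w x - g0 x) ^+ 2) < e / 9.
  apply: (@le_lt_trans _ _ (integral01 (fun x => 2 * N%:R * `|w x - g_ n x|))).
    apply: le_integral01.
    - apply: (@bounded_integrable01 _ _ ((N%:R + N%:R) ^+ 2)).
        by apply: measurable_funX; apply: measurable_funB.
      move=> x _; rewrite normrX ler_sqr ?nnegrE ?addr_ge0//.
      by rewrite (le_trans (ler_normB _ _))// lerD// clamp_bound.
    - exact: integrable01Z.
    - move=> x _; rewrite -[leLHS]real_normK ?num_real//.
      have d1 : `|w x - g0 x| <= `|w x - g_ n x|.
        rewrite -[w x in leLHS](@clamp_id N%:R) ?clamp_dist// clamp_bound//.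
      have d2 : `|w x - g0 x| <= 2 * N%:R.
        rewrite (le_trans (ler_normB _ _))//.
        by rewrite mulr_natl mulr2n lerD// clamp_bound.
      by rewrite expr2 ler_pM.
  rewrite integral01Z//.
  apply: (@le_lt_trans _ _ (2 * N%:R * (e / 9 / (N%:R + 1) ^+ 2 / 4))).
    by rewrite ler_wpM2l ?mulr_ge0// ltW.
  have -> : 2 * N%:R * (e / 9 / (N%:R + 1) ^+ 2 / 4) =
            (e / 9) * (N%:R / (2 * (N%:R + 1) ^+ 2)) :> R by field; lra.
  rewrite -[ltRHS]mulr1 ltr_pM2l// ltr_pdivrMr ?mul1r; last first.
    by rewrite mulr_gt0// exprn_gt0.
  by nra.
have [m gm] : exists m : nat,
    integral01 (fun x => (g0 x - g0 x * cutoff (m.+3%:R^-1) x) ^+ 2) < e / 9.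
  apply: (dominated_integral01_small
    (f_ := fun m x => (g0 x - g0 x * cutoff (m.+3%:R^-1) x) ^+ 2) _
    (integrable01_cst (N%:R ^+ 2))) => //.
  - move=> m; apply: continuous_measurable01 => x _.
    apply: (@continuous_comp _ _ _ (fun x => g0 x - g0 x * cutoff (m.+3%:R^-1) x)
      (fun y => y ^+ 2)); last exact: exprn_continuous.
    apply: cvgB; first exact: cg0.
    by apply: cvgM; [exact: cg0|exact: cutoff_continuous].
  - move=> m x _; rewrite normrX ler_sqr ?nnegrE//.
    have /andP[c0 c1] := cutoff_ge0_le1 m.+3%:R^-1 x.
    have := clamp_bound (g_ n x) N0; rewrite -/(g0 x) => g0N.
    rewrite -[X in X - _]mulr1 -mulrBr normrM.
    by rewrite -[leRHS]mulr1 ler_pM// ger0_norm; lra.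
  - move=> x /andP[x0 x1].
    pose t := Num.min x (1 - x).
    have t0 : 0 < t by rewrite lt_min x0 subr_gt0.
    near=> m; rewrite cutoff_in ?mulr1 ?subrr ?expr0n//.
    have mt : m.+3%:R^-1 *+ 2 <= t.
      rewrite -[leLHS]mulr_natl ler_pdivrMr// mulrC -ler_pdivrMr//.
      apply: (@le_trans _ _ m%:R); last by rewrite ler_nat -addn3 leq_addr.
      by near: m; exact: nbhs_infty_ger.
    by move: mt; rewrite /t le_min => /andP[-> ?] /=; rewrite lerBrDr addrC -lerBrDr.
pose d : R := m.+3%:R^-1.
have d0 : 0 < d by rewrite invr_gt0.
have cgd : continuous (fun x => g0 x * cutoff d x).
  by move=> x; apply: cvgM; [exact: cg0|exact: cutoff_continuous].
exists (fun x => g0 x * cutoff d x), d; split => //.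
- by rewrite d0 /= ltf_pV2 ?posrE// ltr_nat.
- by move=> x xd; rewrite cutoff_out// mulr0.
- have sub x : (u x - g0 x * cutoff d x) ^+ 2 <= 3 * (u x - w x) ^+ 2 +
    (3 * (w x - g0 x) ^+ 2 + 3 * (g0 x - g0 x * cutoff d x) ^+ 2).
    have := sqr_ge0 (u x - w x - (w x - g0 x)).
    have := sqr_ge0 (u x - w x - (g0 x - g0 x * cutoff d x)).
    have := sqr_ge0 (w x - g0 x - (g0 x - g0 x * cutoff d x)).
    by set p := g0 x * _; nra.
  have mgc : measurable_fun (I01 : set R) (fun x => g0 x * cutoff d x).
    by apply: continuous_measurable01 => x _; exact: cgd.
  have mug : measurable_fun (I01 : set R) (fun x => u x - g0 x * cutoff d x).
    exact: measurable_funB.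
  have bc x : `|g0 x * cutoff d x| <= N%:R.
    rewrite normrM -[leRHS]mulr1 ler_pM// ?clamp_bound//.
    by have /andP[? ?] := cutoff_ge0_le1 d x; rewrite ger0_norm.
  have iuw : integrable01 (fun x => (u x - w x) ^+ 2).
    apply: le_integrable01 u2.
      by apply: measurable_funX; exact: measurable_funB.
    move=> x _; rewrite ger0_norm ?sqr_ge0//.
    rewrite -[leLHS]real_normK ?num_real// -[leRHS]real_normK ?num_real//.
    by rewrite ler_sqr ?nnegrE// clamp_defect.
  have iwg0 : integrable01 (fun x => (w x - g0 x) ^+ 2).
    apply: (@bounded_integrable01 _ _ ((N%:R + N%:R) ^+ 2)).
      by apply: measurable_funX; apply: measurable_funB.
    move=> x _; rewrite normrX ler_sqr ?nnegrE ?addr_ge0//.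
    by rewrite (le_trans (ler_normB _ _))// lerD// clamp_bound.
  have igc : integrable01 (fun x => (g0 x - g0 x * cutoff d x) ^+ 2).
    apply: (@bounded_integrable01 _ _ ((N%:R + N%:R) ^+ 2)).
      by apply: measurable_funX; apply: measurable_funB.
    move=> x _; rewrite normrX ler_sqr ?nnegrE ?addr_ge0//.
    by rewrite (le_trans (ler_normB _ _))// lerD// clamp_bound.
  have i3 := integrable01D (integrable01Z 3 iwg0) (integrable01Z 3 igc).
  apply: (@le_lt_trans _ _ (integral01 (fun x => 3 * (u x - w x) ^+ 2 +
    (3 * (w x - g0 x) ^+ 2 + 3 * (g0 x - g0 x * cutoff d x) ^+ 2)))).
    have i4 := integrable01D (integrable01Z 3 iuw) i3.
    apply: le_integral01 => //; apply: le_integrable01 i4.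
      exact: measurable_funX.
    by move=> x _; rewrite ger0_norm ?sqr_ge0.
  rewrite (integral01D (integrable01Z 3 iuw) i3).
  rewrite (integral01D (integrable01Z 3 iwg0) (integrable01Z 3 igc)).
  by rewrite !integral01Z//; lra.
Unshelve. all: by end_near. Qed.

End Density.

(** * Test functions whose derivative approximates a given function *)

Section Duality.
Context {R : realType}.
Implicit Types f g u v h k : R -> R.
Local Notation mu := (@lebesgue_measure R).

Lemma supported_near (d x : R) f : supported d f -> ~~ (d <= x <= 1 - d) ->
  \forall y \near x, f y = 0.
Proof.
move=> fd; rewrite negb_and -!ltNge => /orP[xd|xd].
  near=> y; apply: fd; rewrite negb_and -!ltNge; apply/orP; left.
  by near: y; exact: lt_nbhsl.
near=> y; apply: fd; rewrite negb_and -!ltNge; apply/orP; right.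
by near: y; exact: lt_nbhsr.
Unshelve. all: by end_near. Qed.

(** Weights are continuous in the open interval only; a factor with compact
    support makes the product continuous on the whole line. *)
Lemma supported_mul_continuous (d : R) k g : 0 < d ->
  (forall x, 0 < x < 1 -> {for x, continuous k}) -> continuous g ->
  supported d g -> continuous (fun x => k x * g x).
Proof.
move=> d0 ck cg gd x; have [x01|x01] := boolP (0 < x < 1).
  by apply: cvgM; [exact: ck|exact: cg].
have xd : ~~ (d <= x <= 1 - d).
  by apply: contra x01 => /andP[? ?]; apply/andP; split; lra.
rewrite /continuous_at (gd _ xd) mulr0; apply: cvg_near_cst.
by near=> y; rewrite (near (supported_near gd xd) y) ?mulr0.
Unshelve. all: by end_near. Qed.

Lemma supported_integrable f (d : R) D : 0 < d < 2^-1 -> continuous f ->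
  supported d f -> measurable D -> mu.-integrable D (EFin \o f).
Proof.
move=> d01 cf fd mD; apply: (@integrableS _ _ _ mu setT) => //.
have fE : EFin \o f = (EFin \o f) \_ `[0, 1].
  apply/funext => x; rewrite patchE; case: ifPn => // x01 /=; congr EFin; apply: fd.
  by apply: contra x01 => /andP[? ?]; rewrite inE /= in_itv /=; apply/andP; split; lra.
rewrite fE; apply: (integrable_mkcond _ _).1 => //.
apply: continuous_compact_integrable; first exact: segment_compact.
exact: continuous_subspaceT.
Qed.

Lemma supported_test_function (d : R) (phi : R -> R) : 0 < d ->
  (forall x, derivable phi x 1) -> continuous (derive1 phi) ->
  supported d phi -> test_function phi.
Proof.
move=> d0 dphi cphi phid; split => //.
apply: (@subset_trans _ `[d, 1 - d]); last first.
  by move=> x; rewrite /= in_itv /= => /andP[? ?]; apply/in_I01; lra.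
rewrite [X in _ `<=` X]((closure_id _).1 (interval_closed _ _)) //.
apply: closureS => x /=; rewrite in_itv /=; apply: contraTT => xd.
by rewrite negbK phid.
Qed.

(** The primitive of f is constant to the right of the support of f, and the
    constant is the integral of f. *)
Lemma primitive_test_function f (d : R) : 0 < d < 2^-1 -> continuous f ->
  supported d f -> integral01 f = 0 ->
  exists psi, [/\ test_function psi, derive1 psi = f & supported d psi].
Proof.
move=> d01 cf fd f0.
pose psi x := \int[mu]_(t in `]-oo, x]) f t.
have dpsi x : derivable psi x 1 /\ derive1 psi x = f x.
  apply: (@continuous_FTC1 _ f -oo%O x (x + 1)) => //.
  - by rewrite ltrDl.
  - exact: (supported_integrable d01).
  - by rewrite ltNyr.
  - exact: cf.
have psid : supported d psi.
  move=> x; rewrite negb_and -!ltNge => /orP[xd|xd].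
    rewrite /psi (@eq_Rintegral _ _ _ _ _ (fun=> 0)).
      by rewrite /Rintegral integral0.
    move=> y; rewrite inE /= in_itv /= => yx; apply: fd.
    by rewrite negb_and -!ltNge (le_lt_trans yx xd).
  rewrite -f0 /psi /integral01 Rintegral_mkcond [RHS]Rintegral_mkcond.
  apply: eq_Rintegral => y _; rewrite !patchE.
  have [yd|/fd ->] := boolP (d <= y <= 1 - d); last by case: ifP; case: ifP.
  rewrite !mem_set//.
  - by apply/in_I01; move: yd d01; lra.
  - by rewrite /= in_itv /=; move: yd xd; lra.
have dpsiE : derive1 psi = f by apply/funext => x; have [] := dpsi x.
exists psi; split => //.
apply: (@supported_test_function d) => //; first by case/andP: d01.
  by move=> x; have [] := dpsi x.
by rewrite dpsiE.
Qed.

(** The mean of the approximation g from [dense_compact_support] is corrected by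
    a multiple t of a fixed bump.  Since u has mean zero, t is controlled by the
    distance from u to g, so the correction costs a constant factor only. *)
Lemma dense_compact_support_mean0 u k (M e : R) : sq_integrable01 u ->
  (forall x, 0 < x < 1 -> 0 < k x <= M) ->
  (forall x, 0 < x < 1 -> {for x, continuous k}) ->
  integral01 (fun x => u x * k x) = 0 -> 0 < e ->
  exists g d, [/\ continuous g, 0 < d < 2^-1, supported d g,
    integral01 (fun x => k x * g x) = 0 &
    integral01 (fun x => (u x - g x) ^+ 2) < e].
Proof.
move=> uL k0 ck u0 e0; have [um u2] := uL.
have mk := continuous_measurable01 ck.
(* The bump used to correct the mean. *)
pose b : R -> R := cutoff 8^-1.
have cb : continuous b by exact: cutoff_continuous.
have bd : supported 8^-1 b by move=> x xd; rewrite /b cutoff_out// invr_gt0.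
have b01 x : 0 <= b x <= 1 by exact: cutoff_ge0_le1.
have M0 : 0 < M.
  have /andP[k1 k2] : 0 < k 2^-1 <= M by apply: k0; apply/andP; split; lra.
  exact: lt_le_trans k2.
have L2bound f (N : R) : continuous f -> (forall x, `|f x| <= N) -> sq_integrable01 f.
  move=> cf fN; apply: (@bounded_sq_integrable01 _ _ N) => //.
  by apply: continuous_measurable01 => x _; exact: cf.
have kL2 : sq_integrable01 k.
  apply: (@bounded_sq_integrable01 _ _ M) => // x /k0 /andP[? ?].
  by rewrite ger0_norm//; exact: ltW.
have bL2 : sq_integrable01 b.
  by apply: (L2bound _ 1) => // x; have /andP[? ?] := b01 x; rewrite ger0_norm.
have kb0 : 0 < integral01 (fun x => k x * b x).
  apply: integral01_gt0; first exact: integrable01_mul.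
    move=> x /k0 /andP[/ltW kx0 _]; have /andP[bx0 _] := b01 x.
    exact: mulr_ge0.
  move=> kb; have /negligibleP : mu.-negligible `[4^-1, 3 / 4].
    apply: negligibleS kb => x /=; rewrite in_itv /= => /andP[? ?] kb0.
    have x01 : 0 < x < 1 by apply/andP; split; lra.
    have /andP[kx0 _] := k0 x x01.
    have /eqP := kb0 ((in_I01 x).2 x01).
    rewrite mulf_eq0 gt_eqF//= /b cutoff_in ?oner_eq0// mulr2n; apply/andP; split; lra.
  move=> /(_ (measurable_itv _)) m0.
  have := @lebesgue_measure_itv R `[4^-1, 3 / 4]; rewrite /= lte_fin ifT; last lra.
  by rewrite -[LHS]/(mu _) [X in X = _ -> _]m0 -EFinB => -[]; lra.
set I := integral01 _ in kb0.
pose C := 2 + 2 * (M / I) ^+ 2.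
have C0 : 0 < C by rewrite /C; have := sqr_ge0 (M / I); lra.
have [g [d [cg d01 gd ug]]] := dense_compact_support uL (divr_gt0 e0 C0).
have [G gG] : exists N, forall x, `|g x| <= N.
  have /compact_bounded : compact (g @` `[0, 1]).
    by apply: continuous_compact; [exact: continuous_subspaceT|exact: segment_compact].
  move=> [N [_ /(_ (N + 1))]]; rewrite ltrDl ltr01 => /(_ isT) gN.
  exists (Num.max 0 (N + 1)) => x; rewrite le_max.
  have [x01|x01] := boolP (0 <= x <= 1).
    by rewrite gN ?orbT//; exists x => //; rewrite /= in_itv.
  rewrite gd ?normr0 ?lexx//; apply: contra x01 => /andP[? ?].
  by move: d01 => /andP[? ?]; apply/andP; split; lra.
have gL2 : sq_integrable01 g by exact: (L2bound _ G).
(* The difference u - g is written u + -1 * g so that the closure properties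
   of square integrable functions apply to it literally. *)
have NgL2 : sq_integrable01 (fun x => - 1 * g x).
  by apply: (@sq_integrable01M _ _ _ 1) => // x _; rewrite normrN1.
have ugL2 : sq_integrable01 (fun x => u x + - 1 * g x) by exact: sq_integrable01D.
pose t := integral01 (fun x => k x * g x) / I.
have ikug := integrable01_mul ugL2 kL2.
have tE : t = - integral01 (fun x => (u x + - 1 * g x) * k x) / I.
  rewrite /t; congr (_ / _); apply/eqP; rewrite -subr_eq0 opprK.
  rewrite -integral01D//; last by exact: integrable01_mul.
  by rewrite -u0; apply/eqP; apply: eq_integral01 => x _; ring.
pose U := integral01 (fun x => (u x + - 1 * g x) ^+ 2).
have UE : U = integral01 (fun x => (u x - g x) ^+ 2).
  by apply: eq_integral01 => x _; rewrite mulN1r.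
have U0 : 0 <= U by apply: integral01_ge0 => x _; exact: sqr_ge0.
have tU : t ^+ 2 <= (M / I) ^+ 2 * U.
  (* Jensen's inequality for the probability measure on (0,1) *)
  have : integral01 (fun x => (u x + - 1 * g x) * k x) ^+ 2 <= M ^+ 2 * U.
    set J := integral01 _.
    have : 0 <= integral01 (fun x => M ^+ 2 * (u x + - 1 * g x) ^+ 2 +
        (J ^+ 2 - 2 * J * ((u x + - 1 * g x) * k x))).
      apply: integral01_ge0 => x /k0 /andP[kx0 kxM].
      set z := u x + - 1 * g x; have := sqr_ge0 (z * k x - J).
      have : (z * k x) ^+ 2 <= M ^+ 2 * z ^+ 2.
        rewrite exprMn mulrC ler_wpM2r ?sqr_ge0//.
        by rewrite ler_sqr ?nnegrE//; exact: ltW.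
      by nra.
    have iJ := integrable01Z (2 * J) ikug.
    rewrite integral01D.
    - rewrite integral01Z; last by case: ugL2.
      by rewrite integral01B// ?integral01_cst ?integral01Z// -/J -/U; [nra|exact: integrable01_cst].
    - by apply: integrable01Z; case: ugL2.
    - by apply: integrable01B => //; exact: integrable01_cst.
  rewrite tE; set J := integral01 _ => JM.
  have -> : (M / I) ^+ 2 * U = (M ^+ 2 * U) / I ^+ 2 by rewrite expr_div_n mulrAC.
  by rewrite expr_div_n sqrrN ler_wpM2r// invr_ge0 sqr_ge0.
pose d' := Num.min d 8^-1.
exists (fun x => g x - t * b x), d'; split.
- by move=> x; apply: cvgB; [exact: cg|apply: cvgM; [exact: cvg_cst|exact: cb]].
- by rewrite lt_min gt_min; move: d01 => /andP[-> ->]; rewrite invr_gt0 /= ltr0n.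
- have d'd : d' <= d by rewrite ge_min lexx.
  have d'8 : d' <= 8^-1 by rewrite ge_min lexx orbT.
  move=> x xd; rewrite gd ?bd ?mulr0 ?subr0//.
    by apply: contra xd => /andP[? ?]; apply/andP; split; lra.
  by apply: contra xd => /andP[? ?]; apply/andP; split; lra.
- transitivity (integral01 (fun x => k x * g x - t * (k x * b x))).
    by apply: eq_integral01 => x _; ring.
  rewrite integral01B ?integral01Z ?/t ?divfK ?subrr ?gt_eqF//.
  + exact: integrable01_mul.
  + exact: integrable01_mul.
  + by apply: integrable01Z; exact: integrable01_mul.
- have iU : integrable01 (fun x => (u x + - 1 * g x) ^+ 2) by case: ugL2.
  have iC := integrable01D (integrable01Z 2 iU) (integrable01_cst (2 * t ^+ 2)).
  apply: (@le_lt_trans _ _ (integral01 (fun x =>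
      2 * (u x + - 1 * g x) ^+ 2 + 2 * t ^+ 2))).
    have sub x : (u x - (g x - t * b x)) ^+ 2 <=
        2 * (u x + - 1 * g x) ^+ 2 + 2 * t ^+ 2.
      have /andP[b0 b1] := b01 x; have := sqr_ge0 (u x - g x - t * b x).
      have : (t * b x) ^+ 2 <= t ^+ 2.
        by rewrite exprMn -[leRHS]mulr1 ler_wpM2l ?sqr_ge0// expr_le1.
      by nra.
    apply: le_integral01 => //; apply: le_integrable01 iC; last first.
      by move=> x _; rewrite ger0_norm ?sqr_ge0.
    apply: measurable_funX; apply: measurable_funB => //.
    apply: continuous_measurable01 => x _.
    by apply: cvgB; [exact: cg|apply: cvgM; [exact: cvg_cst|exact: cb]].
  rewrite integral01D//; last 2 first.
    exact: integrable01Z.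
    exact: integrable01_cst.
  rewrite integral01Z// integral01_cst -/U.
  by move: ug; rewrite -UE ltr_pdivlMr// /C; nra.
Qed.

End Duality.

(** * From Hardy inequalities to Poincare inequalities *)

Section Poincare.
Context {R : realType}.
Implicit Types f g u v h k : R -> R.
Local Notation mu := (@lebesgue_measure R).

(** The dual form of the Poincare inequality with constant B for the weights h
    (in the numerator) and k (in the denominator). *)
Definition hardy h k (B : R) : Prop := forall (psi : R -> R) d,
  0 < d < 2^-1 -> test_function psi -> supported d psi ->
  B * integral01 (fun x => psi x ^+ 2 / h x) <=
  integral01 (fun x => derive1 psi x ^+ 2 / k x).

(** Choose psi with psi' = k g and g close to u in L^2.  Up to the error in this
    approximation,
      int u^2 k = 2 int u psi' - int psi'^2 / k = - 2 int u' psi - int psi'^2 / k,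
    and the Hardy inequality bounds this by
      - 2 int u' psi - B int psi^2 / h <= (1 / B) int u'^2 h. *)
Lemma poincare_of_hardy h k (M B : R) u du :
  (forall x, 0 < x < 1 -> 0 < h x <= M) ->
  (forall x, 0 < x < 1 -> {for x, continuous h}) ->
  (forall x, 0 < x < 1 -> 0 < k x <= M) ->
  (forall x, 0 < x < 1 -> {for x, continuous k}) ->
  0 < B -> hardy h k B -> H1_pair u du ->
  integral01 (fun x => u x * k x) = 0 ->
  B * integral01 (fun x => u x ^+ 2 * k x) <= integral01 (fun x => du x ^+ 2 * h x).
Proof.
move=> h0 ch k0 ck B0 hardyB [/L_on01_sq_integrable uL /L_on01_sq_integrable duL wd] u0.
have M0 : 0 < M.
  have /andP[k1 k2] : 0 < k 2^-1 <= M by apply: k0; apply/andP; split; lra.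
  exact: lt_le_trans k2.
apply/ler_addgt0Pr => e e0.
have [|g [d [cg d01 gd kg0 ug]]] := @dense_compact_support_mean0 _ u k M (e / (B * M)) uL k0 ck u0.
  by rewrite divr_gt0// mulr_gt0.
have [d0 _] := andP d01.
have ckg := supported_mul_continuous d0 ck cg gd.
have kgd : supported d (fun x => k x * g x) by move=> x /gd ->; rewrite mulr0.
have [psi [tpsi dpsi psid]] := primitive_test_function d01 ckg kgd kg0.
have cpsi := test_function_continuous tpsi.
have [um u2] := uL; have [mdu du2] := duL.
have mk := continuous_measurable01 ck; have mh := continuous_measurable01 ch.
have Hpsi := hardyB psi d d01 tpsi psid; have Wpsi := wd psi tpsi.
rewrite dpsi in Hpsi Wpsi.
have cpsi2 : continuous (fun x => psi x ^+ 2).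
  move=> x; apply: (@continuous_comp _ _ _ psi (fun y => y ^+ 2)); first exact: cpsi.
  exact: exprn_continuous.
have bddM f : (forall x, 0 < x < 1 -> 0 < f x <= M) ->
    forall x, 0 < x < 1 -> `|f x| <= M.
  by move=> f0 x /f0 /andP[? ?]; rewrite ger0_norm//; exact: ltW.
have cL2 f : continuous f -> sq_integrable01 f.
  move=> cf; split; first by apply: continuous_measurable01 => x _; exact: cf.
  apply: continuous_integrable01 => x.
  apply: (@continuous_comp _ _ _ f (fun y => y ^+ 2)); first exact: cf.
  exact: exprn_continuous.
have iD f : sq_integrable01 f -> integrable01 (fun x => f x ^+ 2) by case.
have ich f g' : (forall x, 0 < x < 1 -> 0 < f x <= M) ->
    (forall x, 0 < x < 1 -> {for x, continuous f}) ->
    sq_integrable01 g' -> integrable01 (fun x => g' x ^+ 2 * f x).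
  move=> f0 cf g'L; have mf := continuous_measurable01 cf; have [mg' g'2] := g'L.
  apply: le_integrable01 (integrable01Z M g'2).
    by apply: measurable_funM => //; exact: measurable_funX.
  move=> x /f0 /andP[fx0 fxM]; have s0 := sqr_ge0 (g' x).
  by rewrite ger0_norm; nra.
have i1 := ich h du h0 ch duL.
have i2 := integrable01_mul duL (cL2 _ cpsi).
have i3 : integrable01 (fun x => psi x ^+ 2 / h x).
  apply: continuous_integrable01.
  rewrite (_ : (fun x => _) = (fun x => (h x)^-1 * psi x ^+ 2)); last first.
    by apply/funext => x; rewrite mulrC.
  apply: (supported_mul_continuous d0) => //.
    move=> x x01; apply: cvgV; last exact: ch.
    by have /andP[hx0 _] := h0 x x01; rewrite gt_eqF.
  by move=> x /psid ->; rewrite expr0n.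
have i4 := ich k u k0 ck uL.
have i5 := ich k g k0 ck (cL2 _ cg).
have i6 := integrable01_mul uL (cL2 _ ckg).
have gL2 := cL2 _ cg.
have ugL2 : sq_integrable01 (fun x => u x + - 1 * g x).
  apply: sq_integrable01D => //.
  by apply: (@sq_integrable01M _ _ _ 1) => // x _; rewrite normrN1.
have i7 := ich k _ k0 ck ugL2.
have gE : integral01 (fun x => (k x * g x) ^+ 2 / k x) =
    integral01 (fun x => g x ^+ 2 * k x).
  apply: eq_integral01 => x /k0 /andP[kx0 _]; field.
  by rewrite gt_eqF.
rewrite gE in Hpsi.
(* The integrand is h (u' + B psi / h)^2. *)
have P1 : 0 <= integral01 (fun x => du x ^+ 2 * h x + (2 * B * (du x * psi x) +
    B ^+ 2 * (psi x ^+ 2 / h x))).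
  apply: integral01_ge0 => x /h0 /andP[hx0 _].
  have -> : du x ^+ 2 * h x + (2 * B * (du x * psi x) + B ^+ 2 * (psi x ^+ 2 / h x)) =
      h x * (du x + B * psi x / h x) ^+ 2 by field; rewrite gt_eqF.
  by rewrite mulr_ge0 ?sqr_ge0// ltW.
have j2 := integrable01Z (2 * B) i2; have j3 := integrable01Z (B ^+ 2) i3.
rewrite (integral01D i1 (integrable01D j2 j3)) (integral01D j2 j3) in P1.
rewrite (integral01Z _ i2) (integral01Z _ i3) in P1.
have P2 : integral01 (fun x => u x ^+ 2 * k x) =
    integral01 (fun x => 2 * (u x * (k x * g x)) +
     (- 1 * (g x ^+ 2 * k x) + (u x + - 1 * g x) ^+ 2 * k x)).
  by apply: eq_integral01 => x _; ring.
have j6 := integrable01Z 2 i6; have j5 := integrable01Z (- 1) i5.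
rewrite (integral01D j6 (integrable01D j5 i7)) (integral01D j5 i7) in P2.
rewrite (integral01Z _ i6) (integral01Z _ i5) Wpsi in P2.
have P3 : integral01 (fun x => (u x + - 1 * g x) ^+ 2 * k x) <= e / B.
  apply: (@le_trans _ _ (integral01 (fun x => M * (u x - g x) ^+ 2))).
    apply: le_integral01 => //.
      apply: eq_integrable01 (integrable01Z M (iD _ ugL2)) => x _.
      by rewrite mulN1r.
    move=> x /k0 /andP[kx0 kxM]; rewrite mulN1r.
    by have := sqr_ge0 (u x - g x); nra.
  rewrite integral01Z; last first.
    by apply: eq_integrable01 (iD _ ugL2) => x _; rewrite mulN1r.
  apply: (@le_trans _ _ (M * (e / (B * M)))).
    by rewrite ler_wpM2l ?ltW.
  by rewrite le_eqVlt; apply/orP; left; apply/eqP; field; rewrite !gt_eqF.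
rewrite P2.
have P4 : B * integral01 (fun x => (u x + - 1 * g x) ^+ 2 * k x) <= e.
  by move: P3; rewrite ler_pdivlMr// mulrC.
move: P1 P4 Hpsi.
set X1 := integral01 (fun x => du x ^+ 2 * h x).
set X2 := integral01 (fun x => du x * psi x).
set X3 := integral01 (fun x => psi x ^+ 2 / h x).
set X4 := integral01 _.
set X5 := integral01 (fun x => g x ^+ 2 * k x) => P1 P4 Hpsi.
have : B * (B * X3) <= B * X5 by rewrite ler_wpM2l// ltW.
by nra.
Qed.

End Poincare.

(** * Hardy inequalities from Riccati inequalities *)

Section Riccati.
Context {R : realType}.
Implicit Types f g u v h k : R -> R.
Local Notation mu := (@lebesgue_measure R).

Lemma supported_integral01 (a d : R) f : 0 < a -> a <= d -> supported d f ->
  integral01 f = \int[mu]_(x in `[a, 1 - a]) f x.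
Proof.
move=> a0 ad fd; rewrite /integral01 Rintegral_mkcond [RHS]Rintegral_mkcond.
apply: eq_Rintegral => y _; rewrite !patchE.
have [/andP[y1 y2]|/fd ->] := boolP (d <= y <= 1 - d); last by case: ifP; case: ifP.
rewrite !mem_set//; last by apply/in_I01; lra.
by rewrite /= in_itv /=; lra.
Qed.

Lemma supported_derive1 (d : R) (psi : R -> R) : test_function psi ->
  supported d psi -> supported d (derive1 psi).
Proof.
move=> tpsi psid x xd; have dpsi := test_function_is_derive x tpsi.
rewrite derive1E (near_eq_derive (g := cst 0)) ?derive_cst ?oner_eq0//.
exact: (supported_near psid xd).
Qed.

Lemma within_continuousX (A : set R) f n : {within A, continuous f} ->
  {within A, continuous (fun x => f x ^+ n)}.
Proof.
move=> cf; elim: n => [|n IH].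
  by under eq_fun do rewrite expr0; move=> x; exact: cvg_cst.
by under eq_fun do rewrite exprS; move=> x; apply: cvgM; [exact: cf|exact: IH].
Qed.

Lemma within_continuousV (A : set R) f : (forall x, A x -> f x != 0) ->
  {within A, continuous f} -> {within A, continuous (fun x => (f x)^-1)}.
Proof.
move=> f0 /subspace_continuousP cf; apply/subspace_continuousP => x Ax.
by apply: cvgV; [exact: f0|exact: cf].
Qed.

Lemma within_continuousM (A : set R) f g : {within A, continuous f} ->
  {within A, continuous g} -> {within A, continuous (fun x => f x * g x)}.
Proof. by move=> cf cg x; apply: cvgM; [exact: cf|exact: cg]. Qed.

Lemma within_continuousD (A : set R) f g : {within A, continuous f} ->
  {within A, continuous g} -> {within A, continuous (fun x => f x + g x)}.
Proof. by move=> cf cg x; apply: cvgD; [exact: cf|exact: cg]. Qed.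

Lemma integrable_itv (a b : R) f : {within `[a, b], continuous f} ->
  mu.-integrable `[a, b] (EFin \o f).
Proof. by apply: continuous_compact_integrable; exact: segment_compact. Qed.

(** By the Riccati inequality,
      psi'^2 / k - B psi^2 / h - (psi^2 Phi)' >= (psi' - k Phi psi)^2 / k >= 0,
    and (psi^2 Phi)' has integral zero. *)
Lemma hardy_itv_of_riccati (a b B : R) (psi dpsi Phi dPhi h k : R -> R) :
  a <= b -> psi a = 0 -> psi b = 0 ->
  (forall x, a <= x <= b -> is_derive x 1 psi (dpsi x)) ->
  {within `[a, b], continuous psi} ->
  {within `[a, b], continuous dpsi} ->
  (forall x, a <= x <= b -> is_derive x 1 Phi (dPhi x)) ->
  {within `[a, b], continuous Phi} ->
  {within `[a, b], continuous dPhi} ->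
  (forall x, a <= x <= b -> 0 < h x) -> {within `[a, b], continuous h} ->
  (forall x, a <= x <= b -> 0 < k x) -> {within `[a, b], continuous k} ->
  (forall x, a <= x <= b -> k x * Phi x ^+ 2 + B / h x <= - dPhi x) ->
  B * \int[mu]_(x in `[a, b]) (psi x ^+ 2 / h x) <=
  \int[mu]_(x in `[a, b]) (dpsi x ^+ 2 / k x).
Proof.
move=> ab psia psib dp cp cdp dP cP cdP h0 ch k0 ck ric.
have inab x : `[a, b]%classic x -> a <= x <= b by rewrite /= in_itv.
have cV f : (forall x, a <= x <= b -> 0 < f x) -> {within `[a, b], continuous f} ->
    {within `[a, b], continuous (fun x => (f x)^-1)}.
  by move=> f0; apply: within_continuousV => x /inab /f0 fx; rewrite gt_eqF.
have i1 : mu.-integrable `[a, b] (EFin \o (fun x => psi x ^+ 2 / h x)).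
  by apply: integrable_itv; apply: within_continuousM; [exact: within_continuousX|exact: cV].
have i2 : mu.-integrable `[a, b] (EFin \o (fun x => dpsi x ^+ 2 / k x)).
  by apply: integrable_itv; apply: within_continuousM; [exact: within_continuousX|exact: cV].
pose G x := 2 * (psi x * dpsi x) * Phi x + psi x ^+ 2 * dPhi x.
have cG : {within `[a, b], continuous G}.
  apply: within_continuousD; apply: within_continuousM => //.
    apply: within_continuousM; last exact: within_continuousM.
    by move=> x; exact: cvg_cst.
  exact: within_continuousX.
have dG x : a <= x <= b -> is_derive x 1 (fun y => psi y ^+ 2 * Phi y) (G x).
  move=> xab; have := dp x xab; have := dP x xab => ? ?.
  by apply: is_derive_eq; rewrite /G /GRing.scale /=; ring.
have G0 : \int[mu]_(x in `[a, b]) G x = 0.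
  by rewrite (FTC_itv ab cG dG) psia psib expr0n !mul0r subrr.
have iG := integrable_itv cG.
have i3 : mu.-integrable `[a, b] (EFin \o (fun x => B * (psi x ^+ 2 / h x))).
  by apply: integrable_itv; apply: within_continuousM;
    [move=> x; exact: cvg_cst|apply: within_continuousM; [exact: within_continuousX|exact: cV]].
rewrite -(RintegralZl _ _ i1)// -[leLHS]addr0 -G0 -(RintegralD _ i3 iG)//.
apply: le_Rintegral => //; first exact: (integrableD _ i3 iG).
move=> x /inab xab; have hx := h0 x xab; have kx := k0 x xab.
have r : psi x ^+ 2 * (k x * Phi x ^+ 2 + B / h x) <= psi x ^+ 2 * - dPhi x.
  by rewrite ler_wpM2l ?sqr_ge0// ric.
have q : 0 <= (dpsi x - k x * Phi x * psi x) ^+ 2 / k x.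
  by rewrite divr_ge0 ?sqr_ge0// ltW.
have qE : (dpsi x - k x * Phi x * psi x) ^+ 2 / k x =
    dpsi x ^+ 2 / k x - 2 * (psi x * dpsi x) * Phi x + psi x ^+ 2 * (k x * Phi x ^+ 2).
  by field; rewrite gt_eqF.
rewrite qE in q; rewrite /G.
have -> : B * (psi x ^+ 2 / h x) = psi x ^+ 2 * (B / h x) by ring.
by move: r q; rewrite mulrDr mulrN; lra.
Qed.

Lemma hardy_of_riccati (B : R) (Phi dPhi h k : R -> R) :
  (forall x : R, 0 < x < 1 -> is_derive x 1 Phi (dPhi x)) ->
  (forall x, 0 < x < 1 -> {for x, continuous dPhi}) ->
  (forall x, 0 < x < 1 -> 0 < h x) -> (forall x, 0 < x < 1 -> {for x, continuous h}) ->
  (forall x, 0 < x < 1 -> 0 < k x) -> (forall x, 0 < x < 1 -> {for x, continuous k}) ->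
  (forall x, 0 < x < 1 -> k x * Phi x ^+ 2 + B / h x <= - dPhi x) ->
  hardy h k B.
Proof.
move=> dP cdP h0 ch k0 ck ric psi d d01 tpsi psid.
have d0 : 0 < d / 2 by lra.
have dd : d / 2 <= d by lra.
have dpsid := supported_derive1 tpsi psid.
have sq0 f g : supported d f -> supported d (fun x => f x ^+ 2 / g x).
  by move=> fd x /fd ->; rewrite expr0n mul0r.
rewrite (supported_integral01 d0 dd (sq0 _ h psid)).
rewrite (supported_integral01 d0 dd (sq0 _ k dpsid)).
have cpsi := test_function_continuous tpsi; have [_ cdpsi _] := tpsi.
have out x : x = d / 2 \/ x = 1 - d / 2 -> psi x = 0.
  by move=> H; apply: psid; apply/negP => /andP[? ?]; case: H; lra.
have in01 x : d / 2 <= x <= 1 - d / 2 -> 0 < x < 1.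
  by move=> /andP[? ?]; apply/andP; split; lra.
have cin f : (forall x, 0 < x < 1 -> {for x, continuous f}) ->
    {within `[d / 2, 1 - d / 2], continuous f}.
  by move=> cf; apply: continuous_in_subspaceT => x; rewrite inE /= in_itv /= => /in01 /cf.
apply: (@hardy_itv_of_riccati _ _ _ psi (derive1 psi) Phi dPhi) => //.
- by lra.
- by apply: out; left.
- by apply: out; right.
- by move=> x _; exact: test_function_is_derive.
- exact: continuous_subspaceT.
- exact: continuous_subspaceT.
- by move=> x /in01; exact: dP.
- by apply: cin => x x01; exact: is_derive_continuous (dP x x01).
- exact: cin.
- by move=> x /in01; exact: h0.
- exact: cin.
- by move=> x /in01; exact: k0.
- exact: cin.
- by move=> x /in01; exact: ric.
Qed.

End Riccati.

(** * Concave functions on (0,1) *)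

Section Concave.
Context {R : realType}.
Implicit Types h : R -> R.

(** Concavity written without barycentric coefficients. *)
Lemma concave_three_points h x y z : concave_on01 h -> 0 < x -> x < y -> y < z -> z < 1 ->
  h x * (z - y) + h z * (y - x) <= h y * (z - x).
Proof.
move=> hc x0 xy yz z1.
have zx0 : 0 < z - x by lra.
have t0 : 0 <= (z - y) / (z - x) by rewrite divr_ge0; lra.
have t1 : (z - y) / (z - x) <= 1 by rewrite ler_pdivrMr//; lra.
pose t : {i01 R} := Itv01 t0 t1.
have xI : (x : R^o) \in (I01 : set R^o) by rewrite inE; apply/in_I01; lra.
have zI : (z : R^o) \in (I01 : set R^o) by rewrite inE; apply/in_I01; lra.
have : - h (t%:inum * x + (1 - t%:inum) * z) <=
    t%:inum * - h x + (1 - t%:inum) * - h z by exact: hc t x z xI zI.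
rewrite (_ : t%:inum * x + _ = y); last by rewrite /t /=; field; lra.
rewrite /t /= -lerN2 opprK opprD !mulrN !opprK => hy.
have := hy; rewrite -(ler_pM2r zx0); apply: le_trans.
by rewrite le_eqVlt; apply/orP; left; apply/eqP; field; lra.
Qed.

(** Since h is nonnegative near 0, the quotient h(x) / x is nonincreasing: this
    is the inequality of three points with the leftmost point tending to 0. *)
Lemma concave_div_le h x y : concave_on01 h -> (forall x, 0 < x < 1 -> 0 <= h x) ->
  0 < x -> x < y -> y < 1 -> h y * x <= h x * y.
Proof.
move=> hc h0 x0 xy y1; apply/ler_addgt0Pr => e e0.
have hy0 : 0 <= h y by apply: h0; lra.
have hx0 : 0 <= h x by apply: h0; lra.
(* The leftmost of the three points, taken close to 0. *)
pose s := Num.min (x / 2) (e / (h y + 1)).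
have s0 : 0 < s by rewrite lt_min !divr_gt0//; lra.
have sx : s <= x / 2 by rewrite ge_min lexx.
have se : s * (h y + 1) <= e by rewrite -ler_pdivlMr ?ge_min ?lexx ?orbT//; lra.
have hs0 : 0 <= h s by apply: h0; lra.
have := @concave_three_points h s x y hc s0; nra.
Qed.

Lemma concave_on01_reflect h : concave_on01 h -> concave_on01 (fun x => h (1 - x)).
Proof.
move=> hc t x y xI yI.
have rI (z : R) : (z : R^o) \in (I01 : set R^o) -> (1 - z : R^o) \in (I01 : set R^o).
  by rewrite !inE => /in_I01 ?; apply/in_I01; lra.
have : - h (t%:inum * (1 - x) + (1 - t%:inum) * (1 - y)) <=
    t%:inum * - h (1 - x) + (1 - t%:inum) * - h (1 - y).
  exact: hc t (1 - x) (1 - y) (rI _ xI) (rI _ yI).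
by rewrite (_ : t%:inum * (1 - x) + _ = 1 - (t%:inum * x + (1 - t%:inum) * y)); [|ring].
Qed.

Lemma concave_div_ge h x y : concave_on01 h -> (forall x, 0 < x < 1 -> 0 <= h x) ->
  0 < x -> x < y -> y < 1 -> h x * (1 - y) <= h y * (1 - x).
Proof.
move=> hc h0 x0 xy y1.
have := @concave_div_le (fun x => h (1 - x)) (1 - y) (1 - x) (concave_on01_reflect hc).
rewrite !subKr; apply; try lra.
by move=> z z01; apply: h0; lra.
Qed.

Context (h : R -> R).
Context (h_ge0 : forall x, 0 < x < 1 -> 0 <= h x) (h_concave : concave_on01 h).
Context (h_neq0 : exists2 x, I01 x & h x != 0).

Lemma concave_gt0 x : 0 < x < 1 -> 0 < h x.
Proof.
move=> /andP[x0 x1]; have [y /in_I01 /andP[y0 y1] hy] := h_neq0.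
have hy0 : 0 < h y by rewrite lt_neqAle eq_sym hy h_ge0//; lra.
have [xy|yx|->//] := ltgtP x y.
  by have := concave_div_le h_concave h_ge0 x0 xy y1; nra.
by have := concave_div_ge h_concave h_ge0 y0 yx x1; nra.
Qed.

Lemma concave_le_mid x : 0 < x < 1 -> h x <= 2 * h 2^-1.
Proof.
move=> /andP[x0 x1]; have m0 : 0 < h 2^-1 by apply: concave_gt0; lra.
have [xy|yx|->] := ltgtP x 2^-1; last by lra.
- have := concave_div_ge h_concave h_ge0 x0 xy; nra.
- have := @concave_div_le _ _ x h_concave h_ge0 _ yx x1; nra.
Qed.

(** The two monotone quotients h(x) / x and h(x) / (1 - x) enclose h between
    continuous functions that agree at x. *)
Lemma concave_continuous x : 0 < x < 1 -> {for x, continuous h}.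
Proof.
move=> /andP[x0 x1]; have hx : 0 < h x by apply: concave_gt0; lra.
have bound y : 0 < y < 1 -> `|h x - h y| * (x * (1 - x)) <= 2 * h 2^-1 * `|x - y|.
  move=> /andP[y0 y1]; have hy : 0 < h y by apply: concave_gt0; lra.
  have hxM : h x <= 2 * h 2^-1 by apply: concave_le_mid; lra.
  have hyM : h y <= 2 * h 2^-1 by apply: concave_le_mid; lra.
  have [xy|yx|->] := ltgtP x y; last by rewrite !subrr normr0 mul0r mulr0.
    have a1 := concave_div_le h_concave h_ge0 x0 xy y1.
    have a2 := concave_div_ge h_concave h_ge0 x0 xy y1.
    rewrite (ltr0_norm (_ : x - y < 0)); last lra.
    case: (ger0P (h x - h y)) => s.
      have : (h x - h y) * (1 - x) <= 2 * h 2^-1 * (y - x) by nra.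
      have : 0 <= (h x - h y) * (1 - x) by nra.
      nra.
    have : (h y - h x) * x <= 2 * h 2^-1 * (y - x) by nra.
    have : 0 <= (h y - h x) * x by nra.
    nra.
  have a1 := concave_div_le h_concave h_ge0 y0 yx x1.
  have a2 := concave_div_ge h_concave h_ge0 y0 yx x1.
  rewrite (gtr0_norm (_ : 0 < x - y)); last lra.
  case: (ger0P (h x - h y)) => s.
    have : (h x - h y) * x <= 2 * h 2^-1 * (x - y) by nra.
    have : 0 <= (h x - h y) * x by nra.
    nra.
  have : (h y - h x) * (1 - x) <= 2 * h 2^-1 * (x - y) by nra.
  have : 0 <= (h y - h x) * (1 - x) by nra.
  nra.
have m0 : 0 < h 2^-1 by apply: concave_gt0; lra.
have xnear : forall e : R, 0 < e -> \forall y \near x, `|x - y| < e.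
  by have /cvgrPdist_lt := @cvg_id _ (nbhs x).
apply/cvgrPdist_lt => e e0; near=> y.
have y01 : 0 < y < 1.
  by apply/andP; split; near: y; [exact: lt_nbhsr|exact: lt_nbhsl].
have xx0 : 0 < x * (1 - x) by nra.
have d : `|x - y| < e * (x * (1 - x)) / (2 * h 2^-1).
  near: y; apply: xnear.
  by rewrite divr_gt0 ?mulr_gt0//; lra.
rewrite -(ltr_pM2r xx0); apply: le_lt_trans (bound y y01) _.
by rewrite mulrC -ltr_pdivlMr//; lra.
Unshelve. all: by end_near. Qed.

End Concave.

(** * Comparison of a concave weight with a tent *)

Section LowerBounds.
Context {R : realType}.
Implicit Types f g u v h k : R -> R.
Local Notation mu := (@lebesgue_measure R).

(** The Riccati equation for a logarithmic derivative. *)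
Lemma is_derive_logderivative (w w1 w2 : R -> R) (x : R) : w x != 0 ->
  is_derive x 1 w (w1 x) -> is_derive x 1 w1 (w2 x) ->
  is_derive x 1 (fun y => w1 y / w y) (w2 x / w x - (w1 x / w x) ^+ 2).
Proof.
move=> w0 dw dw1; have dV := is_deriveV w0 dw.
by apply: is_derive_eq; rewrite /GRing.scale /=; field.
Qed.

Context (h : R -> R).
Context (h_ge0 : forall x, 0 < x < 1 -> 0 <= h x) (h_concave : concave_on01 h).
Context (h_neq0 : exists2 x, I01 x & h x != 0).

(** This is the supersolution property of the cubic of [hardy_tent] to the left
    of the peak c of the tent, where p = 1 - 2 c and the common factor x has been
    removed.  Multiply by 2 - 3 p and replace the constant on the right by the
    smaller number 1 - p / 2: the two sides then agree at x = 0, and they differ by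
    x times a positive factor.  By symmetry, the inequality with -p and 1 - x serves
    to the right of c. *)
Lemma cubic_weight_left (p x : R) : - 3^-1 <= p <= 3^-1 -> 0 < x < 1 ->
  (1 - x) * (1 + p * (x - 2^-1)) <=
  (2 + 6 * p * (x - 2^-1)) * (2^-1 * (1 + p) * (1 + 3 * p ^+ 2)).
Proof.
move=> /andP[p0 p1] /andP[x0 x1].
have p2 : 0 <= p ^+ 2 := sqr_ge0 p.
have a0 : 0 < 2 - 3 * p by lra.
have l0 : 0 < 2 + 6 * p * (x - 2^-1) by nra.
have e1 : (1 - x) * (1 + p * (x - 2^-1)) * (2 - 3 * p) <=
    (2 + 6 * p * (x - 2^-1)) * (1 - p / 2).
  rewrite -subr_ge0 (_ : _ - _ = x * (2 + 3 / 2 * p ^+ 2 + p * (2 - 3 * p) * x)).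
    rewrite mulr_ge0//; first lra.
    have : -1 <= p * (2 - 3 * p) by nra.
    by nra.
  by field.
have e2 : 1 - p / 2 <= (2^-1 * (1 + p) * (1 + 3 * p ^+ 2)) * (2 - 3 * p).
  rewrite -subr_ge0 (_ : _ - _ = 3 / 2 * p ^+ 2 * (1 - p - 3 * p ^+ 2)).
    by rewrite mulr_ge0//; nra.
  by field.
rewrite -(ler_pM2r a0); apply: le_trans e1 _.
by rewrite -[leRHS]mulrA ler_wpM2l// ltW.
Qed.

(** The supersolution is w = x (1 - x) (1 + p (x - 1/2)), p = 1 - 2 c.  At the
    symmetric tent, c = 1/2, it is the parabola, with - w'' = 2; for other c the
    linear factor balances, to first order in p, the values of - w'' T / w at the
    two end points, T being the tent.  The constant is the one that matches
    [sqr_integral_le_second_moment]. *)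
Lemma hardy_tent (c : R) : 3^-1 <= c <= 2 / 3 ->
  hardy h (fun=> 1) (h c / (4 * (c * (1 - c)) * (1 - 3 * (c * (1 - c))))).
Proof.
move=> c13; set q := c * (1 - c); set B := h c / _.
pose p := 1 - 2 * c.
have p13 : - 3^-1 <= p <= 3^-1 by rewrite /p; apply/andP; split; lra.
have h0 := concave_gt0 h_ge0 h_concave h_neq0.
have hc0 : 0 < h c by apply: h0; lra.
pose w x := x * (1 - x) * (1 + p * (x - 2^-1)).
pose w1 x := (1 - 2 * x) * (1 + p * (x - 2^-1)) + p * (x * (1 - x)).
pose w2 x := - (2 + 6 * p * (x - 2^-1)).
have w0 x : 0 < x < 1 -> 0 < w x.
  move=> /andP[x0 x1]; have ? : 0 < 1 + p * (x - 2^-1) by nra.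
  by apply: mulr_gt0 => //; apply: mulr_gt0 => //; lra.
have dw (x : R) : is_derive x 1 w (w1 x).
  by apply: is_derive_eq; rewrite /w1 /GRing.scale /=; ring.
have dw1 (x : R) : is_derive x 1 w1 (w2 x).
  by apply: is_derive_eq; rewrite /w2 /GRing.scale /=; field.
have cw : continuous w.
  by move=> x; exact: is_derive_continuous (dw x).
have cw1 : continuous w1.
  by move=> x; exact: is_derive_continuous (dw1 x).
have cw2 : continuous w2.
  have dw2 (x : R) : is_derive x 1 w2 (- (6 * p)).
    by apply: is_derive_eq; rewrite /GRing.scale /=; ring.
  by move=> x; exact: is_derive_continuous (dw2 x).
pose Phi x := w1 x / w x.
pose dPhi x := w2 x / w x - (w1 x / w x) ^+ 2.
apply: (@hardy_of_riccati _ _ Phi dPhi).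
- by move=> x /w0 wx; apply: is_derive_logderivative; rewrite ?gt_eqF.
- move=> x /w0 wx; have cV : {for x, continuous (fun y => (w y)^-1)}.
    by apply: cvgV; [rewrite gt_eqF|exact: cw].
  apply: cvgB; first by apply: cvgM; [exact: cw2|exact: cV].
  by apply: cvgM; apply: cvgM; do [exact: cw1|exact: cV].
- exact: h0.
- by move=> x x01; exact: concave_continuous.
- by move=> x _; exact: ltr01.
- by move=> x _; exact: cvg_cst.
- move=> x x01; have wx := w0 x x01; have hx := h0 x x01.
  rewrite /dPhi -/(Phi x) mul1r opprB lerD2l /w2 mulNr opprK.
  rewrite ler_pdivrMr// mulrAC ler_pdivlMr//.
  have qE : 4 * q * (1 - 3 * q) = (1 - p ^+ 2) * (1 + 3 * p ^+ 2) / 4.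
    by rewrite /q /p; field.
  have D0 : 0 < 4 * q * (1 - 3 * q).
    have p2 : 0 <= p ^+ 2 := sqr_ge0 p.
    have p9 : p ^+ 2 <= 9^-1 by nra.
    by rewrite qE divr_gt0// mulr_gt0//; lra.
  rewrite /B mulrAC ler_pdivrMr//.
  have l0 : 0 < 2 + 6 * p * (x - 2^-1) by nra.
  have [xc|xc] := ltP x c.
    have t : h c * x <= h x * c by apply: concave_div_le => //; lra.
    have e := cubic_weight_left p13 x01.
    have -> : h c * w x = h c * x * ((1 - x) * (1 + p * (x - 2^-1))) by rewrite /w; ring.
    have qK : 4 * q * (1 - 3 * q) = c * (2^-1 * (1 + p) * (1 + 3 * p ^+ 2)).
      by rewrite qE /p; field.
    have hcx0 : 0 <= h c * x by rewrite mulr_ge0//; lra.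
    have e0 : 0 <= (1 - x) * (1 + p * (x - 2^-1)) by rewrite mulr_ge0//; nra.
    apply: le_trans (ler_pM hcx0 e0 t e) _.
    by rewrite qK le_eqVlt; apply/orP; left; apply/eqP; ring.
  have t : h c * (1 - x) <= h x * (1 - c).
    by move: xc; rewrite le_eqVlt => /orP[/eqP <-//|cx]; apply: concave_div_ge => //; lra.
  have Np13 : - 3^-1 <= - p <= 3^-1 by lra.
  have x01' : 0 < 1 - x < 1 by lra.
  have e := cubic_weight_left Np13 x01'.
  have -> : h c * w x = h c * (1 - x) *
      ((1 - (1 - x)) * (1 + - p * ((1 - x) - 2^-1))) by rewrite /w; field.
  have qK : 4 * q * (1 - 3 * q) = (1 - c) * (2^-1 * (1 + - p) * (1 + 3 * (- p) ^+ 2)).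
    by rewrite qE /p; field.
  have hcx0 : 0 <= h c * (1 - x) by rewrite mulr_ge0//; lra.
  have e0 : 0 <= (1 - (1 - x)) * (1 + - p * ((1 - x) - 2^-1)).
    by rewrite mulr_ge0//; nra.
  apply: le_trans (ler_pM hcx0 e0 t e) _.
  by rewrite qK le_eqVlt; apply/orP; left; apply/eqP; field.
Qed.

End LowerBounds.

(** * The Payne-Weinberger inequality *)

Section PayneWeinberger.
Context {R : realType}.
Implicit Types f g u v h k : R -> R.
Local Notation mu := (@lebesgue_measure R).

Lemma is_derive_translate f (e x df : R) : is_derive (x + e) 1 f df ->
  is_derive x 1 (fun y => f (y + e)) df.
Proof.
move=> dfx; have dg : is_derive x 1 (fun y : R => y + e) 1.
  by apply: is_derive_eq; rewrite addr0.
by have := @is_derive1_comp _ f (fun y => y + e) x _ _ dfx dg; rewrite mulr1.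
Qed.

Lemma primitive_itv f (l a u : R) : l < a ->
  (forall x, l < x < u -> {for x, continuous f}) ->
  exists F : R -> R, forall x : R, a < x < u -> is_derive x 1 F (f x).
Proof.
move=> la cf; exists (fun x => \int[mu]_(t in `[a, x]) f t) => x /andP[ax xu].
have xm : x < (x + u) / 2 by lra.
have If : mu.-integrable `[a, (x + u) / 2] (EFin \o f).
  apply: integrable_itv; apply: continuous_in_subspaceT => y.
  by rewrite inE /= in_itv /= => /andP[? ?]; apply: cf; lra.
have cfx : {for x, continuous f} by apply: cf; lra.
have [dF <-] := continuous_FTC1_closed xm If ax cfx.
by rewrite derive1E; exact: derivableP.
Qed.

Lemma mean_value f (df : R -> R) (a b : R) : a < b ->
  (forall x, a <= x <= b -> is_derive x 1 f (df x)) ->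
  exists2 c, a < c < b & f b - f a = df c * (b - a).
Proof.
move=> ab dfx; have [||c cab E] := @MVT _ f df a b ab.
- by move=> x; rewrite in_itv /= => /andP[? ?]; apply: dfx; lra.
- apply: continuous_in_subspaceT => x; rewrite inE /= in_itv /= => /dfx.
  exact: is_derive_continuous.
- by exists c => //; move: cab; rewrite in_itv.
Qed.

(** If h is the second derivative of G2, then the second difference quotient of G2
    is an iterated average of h. *)
Lemma second_difference_mean_value (G2 G1 h : R -> R) (x e : R) : 0 < e ->
  (forall y : R, x <= y <= x + e + e -> is_derive y 1 G2 (G1 y)) ->
  (forall y : R, x <= y <= x + e + e -> is_derive y 1 G1 (h y)) ->
  exists2 y, x < y < x + e + e &
    G2 (x + e + e) - 2 * G2 (x + e) + G2 x = h y * e ^+ 2.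
Proof.
move=> e0 dG2 dG1.
have xe : x < x + e by lra.
have d1 (y : R) : x <= y <= x + e ->
    is_derive y 1 (fun z => G2 (z + e) - G2 z) (G1 (y + e) - G1 y).
  move=> /andP[? ?]; apply: is_deriveB; last by apply: dG2; lra.
  by apply: is_derive_translate; apply: dG2; lra.
have [y1 /andP[y1x y1e] E1] := mean_value xe d1.
have ye : y1 < y1 + e by lra.
have d2 (y : R) : y1 <= y <= y1 + e -> is_derive y 1 G1 (h y).
  by move=> /andP[? ?]; apply: dG1; lra.
have [y2 /andP[y2x y2e] E2] := mean_value ye d2.
exists y2; first by lra.
rewrite [RHS](_ : _ = h y2 * (y1 + e - y1) * (x + e - x)); last by ring.
by rewrite -E2 -E1; ring.
Qed.

(** Averaging h twice over intervals of length e gives a function whose second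
    derivative is a second difference quotient of h, hence nonpositive.  The
    average is a value h(y) with x < y < x + 2 e, and the monotone quotients
    h(x) / x and h(x) / (1 - x) bound h(y) / h(x). *)
Lemma concave_smoothing h (a eta : R) :
  (forall x, 0 < x < 1 -> 0 <= h x) -> concave_on01 h ->
  (exists2 x, I01 x & h x != 0) -> 0 < a < 2^-1 -> 0 < eta < 1 ->
  exists g g1 g2 : R -> R, [/\
    (forall x : R, a <= x <= 1 - a -> is_derive x 1 g (g1 x)),
    (forall x : R, a <= x <= 1 - a -> is_derive x 1 g1 (g2 x)),
    (forall x : R, a <= x <= 1 - a -> {for x, continuous g2}),
    (forall x : R, a <= x <= 1 - a -> g2 x <= 0) &
    (forall x : R, a <= x <= 1 - a -> (1 - eta) * h x <= g x <= (1 + eta) * h x)].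
Proof.
move=> h_ge0 hc h_neq0 /andP[a0 a2] /andP[eta0 eta1].
have h0 := concave_gt0 h_ge0 hc h_neq0.
have ch := concave_continuous h_ge0 hc h_neq0.
have a4 : 0 < a / 4 by lra.
have a42 : a / 4 < a / 2 by lra.
have [G1 dG1] := primitive_itv a4 ch.
have cG1 x : a / 4 < x < 1 -> {for x, continuous G1}.
  by move=> /dG1; exact: is_derive_continuous.
have [G2 dG2] := primitive_itv a42 cG1.
pose e := eta * a / 2.
have e0 : 0 < e by rewrite /e divr_gt0// mulr_gt0.
have ea : e < a / 2 by rewrite /e ltr_pM2r//; nra.
(* G1 and G2 are successive primitives of h, so D2 G2 is the iterated average
   and D2 h its second derivative. *)
pose D2 (f : R -> R) x := (f (x + e + e) - 2 * f (x + e) + f x) / e ^+ 2.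
have dD2 f df : (forall y : R, a / 2 < y < 1 -> is_derive y 1 f (df y)) ->
    forall x : R, a <= x <= 1 - a -> is_derive x 1 (D2 f) (D2 df x).
  move=> dfy x /andP[xa xa'].
  have d0 : is_derive x 1 f (df x) by apply: dfy; lra.
  have d1 : is_derive x 1 (fun y => f (y + e)) (df (x + e)).
    by apply: is_derive_translate; apply: dfy; lra.
  have d2 : is_derive x 1 (fun y => f (y + e + e)) (df (x + e + e)).
    apply: (@is_derive_translate (fun y => f (y + e))).
    by apply: is_derive_translate; apply: dfy; lra.
  by rewrite /D2; apply: is_derive_eq; rewrite /GRing.scale /=; ring.
have cD2 (x : R) : a <= x <= 1 - a -> {for x, continuous (D2 h)}.
  move=> /andP[xa xa'].
  have c0 : {for x, continuous h} by apply: ch; lra.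
  have ct b : 0 < x + b < 1 -> {for x, continuous (fun y => h (y + b))}.
    move=> xb; apply: (@continuous_comp _ _ _ (fun y : R => y + b) h).
      by apply: cvgD; [exact: cvg_id|exact: cvg_cst].
    exact: ch.
  have c1 : {for x, continuous (fun y => h (y + e))} by apply: ct; lra.
  have c2 : {for x, continuous (fun y => h (y + e + e))}.
    rewrite (_ : (fun y => _) = (fun y => h (y + (e + e)))); first by apply: ct; lra.
    by apply/funext => y; rewrite addrA.
  apply: cvgM; last exact: cvg_cst.
  apply: cvgD; last exact: c0.
  by apply: cvgB; [exact: c2|apply: cvgM; [exact: cvg_cst|exact: c1]].
exists (D2 G2), (D2 G1), (D2 h); split.
- by apply: dD2.
- by apply: dD2 => y ?; apply: dG1; lra.
- exact: cD2.
- move=> x /andP[xa xa']; rewrite /D2 pmulr_lle0 ?invr_gt0 ?exprn_gt0//.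
  have xe : x < x + e by lra.
  have xee : x + e < x + e + e by lra.
  have x0 : 0 < x by lra.
  have x1 : x + e + e < 1 by lra.
  have := concave_three_points hc x0 xe xee x1.
  by move: (h x) (h (x + e)) (h (x + e + e)) => hx hm hz; nra.
- move=> x /andP[xa xa'].
  have dd2 (y : R) : x <= y <= x + e + e -> is_derive y 1 G2 (G1 y).
    by move=> /andP[? ?]; apply: dG2; lra.
  have dd1 (y : R) : x <= y <= x + e + e -> is_derive y 1 G1 (h y).
    by move=> /andP[? ?]; apply: dG1; lra.
  have [y /andP[xy yx] E] := second_difference_mean_value e0 dd2 dd1.
  rewrite /D2 E mulfK; last by rewrite gt_eqF// exprn_gt0.
  have x0 : 0 < x by lra.
  have y1 : y < 1 by lra.
  have b1 := concave_div_le hc h_ge0 x0 xy y1.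
  have b2 := concave_div_ge hc h_ge0 x0 xy y1.
  have hx : 0 < h x by apply: h0; lra.
  have hy : 0 < h y by apply: h0; lra.
  have yx' : y - x <= eta * a by move: yx; rewrite /e; lra.
  apply/andP; split.
    have x1 : 0 < 1 - x by lra.
    rewrite -(ler_pM2r x1); apply: le_trans b2.
    by rewrite -mulrA mulrCA ler_wpM2l// ?(ltW hx)//; nra.
  rewrite -(ler_pM2r x0); apply: le_trans b1 _.
  by rewrite [_ * h x]mulrC -mulrA ler_wpM2l// ?(ltW hx)//; nra.
Qed.

(** The supersolution is w = sqrt(g) sin (pi x), so that Phi = N / g where
    N = pi cot (pi x) + g' / (2 g).  The defect in the Riccati inequality, multiplied
    by g, is 3/4 (g' / g)^2 - g'' / (2 g), which is nonnegative when g is concave. *)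
Lemma hardy_itv_smooth (a b : R) (psi dpsi g g1 g2 : R -> R) :
  0 < a -> a <= b -> b < 1 -> psi a = 0 -> psi b = 0 ->
  (forall x : R, a <= x <= b -> is_derive x 1 psi (dpsi x)) ->
  (forall x : R, a <= x <= b -> {for x, continuous dpsi}) ->
  (forall x : R, a <= x <= b -> is_derive x 1 g (g1 x)) ->
  (forall x : R, a <= x <= b -> is_derive x 1 g1 (g2 x)) ->
  (forall x : R, a <= x <= b -> {for x, continuous g2}) ->
  (forall x : R, a <= x <= b -> 0 < g x) ->
  (forall x : R, a <= x <= b -> g2 x <= 0) ->
  pi ^+ 2 * \int[mu]_(x in `[a, b]) (psi x ^+ 2 / g x) <=
  \int[mu]_(x in `[a, b]) (dpsi x ^+ 2 / g x).
Proof.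
move=> a0 ab b1 psia psib dp cdp dg dg1 cg2 g0 g20.
have cw f : (forall x, a <= x <= b -> {for x, continuous f}) ->
    {within `[a, b], continuous f}.
  by move=> cf; apply: continuous_in_subspaceT => x; rewrite inE /= in_itv /= => /cf.
pose S (x : R) := sin (pi * x); pose S1 (x : R) := pi * cos (pi * x).
pose S2 (x : R) := - pi ^+ 2 * sin (pi * x).
have dpix (x : R) : is_derive x 1 (fun y : R => pi * y) pi.
  by apply: is_derive_eq; rewrite /GRing.scale /=; ring.
have dS (x : R) : is_derive x 1 S (S1 x).
  have := @is_derive1_comp _ sin (fun y : R => pi * y) x _ _ (is_derive_sin _) (dpix x).
  by rewrite mulrC.
have dS1 (x : R) : is_derive x 1 S1 (S2 x).
  have dc := @is_derive1_comp _ cos (fun y : R => pi * y) x _ _ (is_derive_cos _) (dpix x).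
  by apply: is_derive_eq; rewrite /S2 /GRing.scale /=; ring.
have S0 x : a <= x <= b -> 0 < S x.
  move=> xab; apply: sin_gt0_pi; have := pi_gt0 R => pi0.
  by apply/andP; split; nra.
have cS (x : R) : {for x, continuous S} := is_derive_continuous (dS x).
have cS1 (x : R) : {for x, continuous S1} := is_derive_continuous (dS1 x).
have cg (x : R) : a <= x <= b -> {for x, continuous g}.
  by move=> /dg; exact: is_derive_continuous.
have cg1 (x : R) : a <= x <= b -> {for x, continuous g1}.
  by move=> /dg1; exact: is_derive_continuous.
pose C x := S1 x / S x; pose E x := g1 x / g x.
pose N x := C x + 2^-1 * E x.
pose dN x := (- pi ^+ 2 - C x ^+ 2) + 2^-1 * (g2 x / g x - E x ^+ 2).
have dNx x : a <= x <= b -> is_derive x 1 N (dN x).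
  move=> xab; have Sx := S0 x xab; have gx := g0 x xab.
  have dC : is_derive x 1 C (S2 x / S x - (S1 x / S x) ^+ 2).
    by apply: is_derive_logderivative; rewrite ?gt_eqF.
  have dE : is_derive x 1 E (g2 x / g x - (g1 x / g x) ^+ 2).
    by apply: is_derive_logderivative; rewrite ?gt_eqF//; [exact: dg|exact: dg1].
  apply: is_derive_eq; rewrite /dN /S2 /C /E /GRing.scale /= -/(S x).
  by field; rewrite !gt_eqF.
pose Phi x := N x / g x; pose dPhi x := dN x / g x - N x * g1 x / g x ^+ 2.
have dPhix x : a <= x <= b -> is_derive x 1 Phi (dPhi x).
  move=> xab; have gx := g0 x xab; have dNx' := dNx x xab; have dgx := dg x xab.
  have gn0 : g x != 0 by rewrite gt_eqF.
  have dV := is_deriveV gn0 dgx.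
  by apply: is_derive_eq; rewrite /dPhi /GRing.scale /=; field.
have cV f (x : R) : 0 < f x -> {for x, continuous f} ->
    {for x, continuous (fun y => (f y)^-1)}.
  by move=> fx cf; apply: cvgV => //; rewrite gt_eqF.
have cC x : a <= x <= b -> {for x, continuous C}.
  by move=> xab; apply: cvgM; [exact: cS1|apply: cV; [exact: S0|exact: cS]].
have cE x : a <= x <= b -> {for x, continuous E}.
  by move=> xab; apply: cvgM; [exact: cg1|apply: cV; [exact: g0|exact: cg]].
have cN x : a <= x <= b -> {for x, continuous N}.
  by move=> /dNx; exact: is_derive_continuous.
have cdN x : a <= x <= b -> {for x, continuous dN}.
  move=> xab; apply: cvgD.
    by apply: cvgB; [exact: cvg_cst|apply: cvgM; exact: cC].
  apply: cvgM; first exact: cvg_cst.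
  apply: cvgB; last by apply: cvgM; exact: cE.
  by apply: cvgM; [exact: cg2|apply: cV; [exact: g0|exact: cg]].
have cdPhi x : a <= x <= b -> {for x, continuous dPhi}.
  move=> xab; apply: cvgB.
    by apply: cvgM; [exact: cdN|apply: cV; [exact: g0|exact: cg]].
  apply: cvgM; first by apply: cvgM; [exact: cN|exact: cg1].
  apply: (cV (fun y => g y ^+ 2)); first by rewrite exprn_gt0// g0.
  by apply: cvgM; exact: cg.
apply: (@hardy_itv_of_riccati _ _ _ _ psi dpsi Phi dPhi g g ab psia psib dp).
- by apply: cw => x /dp; exact: is_derive_continuous.
- exact: cw.
- by apply: cw => x /dPhix; exact: is_derive_continuous.
- exact: cw.
- exact: g0.
- exact: cw.
- exact: g0.
- exact: cw.
move=> x xab; have gx := g0 x xab; have g2x := g20 x xab.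
rewrite -(ler_pM2r gx).
have -> : (g x * Phi x ^+ 2 + pi ^+ 2 / g x) * g x = N x ^+ 2 + pi ^+ 2.
  by rewrite /Phi; field; rewrite gt_eqF.
have -> : - dPhi x * g x = - dN x + N x * E x.
  by rewrite /dPhi /E; field; rewrite gt_eqF.
have g2g : g2 x / g x <= 0 by rewrite pmulr_lle0 ?invr_gt0.
rewrite /dN /N; have := sqr_ge0 (E x).
move: (C x) (E x) (g2 x / g x) g2g => c e z ? ?; nra.
Qed.

(** The smooth case for an average g with (1 - eta) h <= g <= (1 + eta) h, and then
    eta tends to 0. *)
Lemma hardy_concave h : (forall x, 0 < x < 1 -> 0 <= h x) -> concave_on01 h ->
  (exists2 x, I01 x & h x != 0) -> hardy h h (pi ^+ 2).
Proof.
move=> h_ge0 hc h_neq0 psi d d01 tpsi psid.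
have h0 := concave_gt0 h_ge0 hc h_neq0.
have ch := concave_continuous h_ge0 hc h_neq0.
have a0 : 0 < d / 2 by lra.
have ad : d / 2 <= d by lra.
have dpsid := supported_derive1 tpsi psid.
have sq0 f g : supported d f -> supported d (fun x => f x ^+ 2 / g x).
  by move=> fd x /fd ->; rewrite expr0n mul0r.
rewrite (supported_integral01 a0 ad (sq0 _ h psid)).
rewrite (supported_integral01 a0 ad (sq0 _ h dpsid)).
have ad' : d / 2 < d by lra.
move: (d / 2) a0 ad ad' => a a0 ad ad'.
have cpsi := test_function_continuous tpsi; have [_ cdpsi _] := tpsi.
have out x : x = a \/ x = 1 - a -> psi x = 0.
  by move=> H; apply: psid; apply/negP => /andP[? ?]; case: H; lra.
have in01 x : a <= x <= 1 - a -> 0 < x < 1.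
  by move=> /andP[? ?]; apply/andP; split; lra.
have cw f : (forall x, a <= x <= 1 - a -> {for x, continuous f}) ->
    {within `[a, 1 - a], continuous f}.
  by move=> cf; apply: continuous_in_subspaceT => x; rewrite inE /= in_itv /= => /cf.
set X := Rintegral _ _ _; set Y := Rintegral _ _ _.
have main eta : 0 < eta < 1 -> (1 - eta) * (pi ^+ 2 * X) <= (1 + eta) * Y.
  move=> eta01; have /andP[eta0 eta1] := eta01.
  have a01 : 0 < a < 2^-1 by apply/andP; split => //; lra.
  have [g [g1 [g2 [dg dg1 cg2 g20 gh]]]] := concave_smoothing h_ge0 hc h_neq0 a01 eta01.
  have g0 x : a <= x <= 1 - a -> 0 < g x.
    move=> xa; have /andP[+ _] := gh x xa; apply: lt_le_trans.
    by rewrite mulr_gt0 ?h0//; [lra|exact: in01].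
  have cg x : a <= x <= 1 - a -> {for x, continuous g}.
    by move=> /dg; exact: is_derive_continuous.
  have aa : a <= 1 - a by lra.
  have a1 : 1 - a < 1 by lra.
  have P := hardy_itv_smooth a0 aa a1 (out _ (or_introl erefl)) (out _ (or_intror erefl))
    (fun x _ => test_function_is_derive x tpsi) (fun x _ => cdpsi x) dg dg1 cg2 g0 g20.
  have iq f k : continuous f -> (forall x, a <= x <= 1 - a -> 0 < k x) ->
      (forall x, a <= x <= 1 - a -> {for x, continuous k}) ->
      mu.-integrable `[a, 1 - a] (EFin \o (fun x => f x ^+ 2 / k x)).
    move=> cf k0 ck; apply: integrable_itv; apply: cw => x xa.
    apply: cvgM; first by apply: cvgM; exact: cf.
    by apply: cvgV; [rewrite gt_eqF// k0|exact: ck].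
  have h0' x : a <= x <= 1 - a -> 0 < h x by move=> /in01; exact: h0.
  have ch' x : a <= x <= 1 - a -> {for x, continuous h} by move=> /in01; exact: ch.
  have inset x : `[a, 1 - a]%classic x -> a <= x <= 1 - a by rewrite /= in_itv.
  have mS : measurable (`[a, 1 - a]%classic : set R) by exact: measurable_itv.
  have ihX := iq psi h cpsi h0' ch'; have igX := iq psi g cpsi g0 cg.
  have ihY := iq _ h cdpsi h0' ch'; have igY := iq _ g cdpsi g0 cg.
  have l1 : X <= (1 + eta) * \int[mu]_(x in `[a, 1 - a]) (psi x ^+ 2 / g x).
    rewrite -(RintegralZl _ _ igX)//; apply: le_Rintegral => //.
      exact: (integrableZl _ _ igX).
    move=> x /inset xa; have /andP[_ gx] := gh x xa.
    rewrite mulrCA ler_wpM2l ?sqr_ge0//.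
    rewrite -[(h x)^-1]mul1r ler_pdivrMr ?h0'// mulrAC ler_pdivlMr ?g0//.
    by rewrite mul1r.
  have l2 : (1 - eta) * \int[mu]_(x in `[a, 1 - a]) (derive1 psi x ^+ 2 / g x) <= Y.
    rewrite -(RintegralZl _ _ igY)//; apply: le_Rintegral => //.
      exact: (integrableZl _ _ igY).
    move=> x /inset xa; have /andP[gx _] := gh x xa.
    rewrite mulrCA ler_wpM2l ?sqr_ge0//.
    rewrite -[(h x)^-1]mul1r ler_pdivrMr ?g0// mulrAC ler_pdivlMr ?h0'//.
    by rewrite mul1r.
  have p0 : 0 <= (pi : R) ^+ 2 := sqr_ge0 _.
  have e1 : 0 < 1 - eta by rewrite subr_gt0.
  have e2 : 0 < 1 + eta by rewrite addr_gt0.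
  move: P l1 l2.
  set U := Rintegral _ _ _; set V := Rintegral _ _ _ => P l1 l2.
  have s1 : (1 - eta) * (pi ^+ 2 * X) <= (1 - eta) * (pi ^+ 2 * ((1 + eta) * U)).
    by rewrite ler_pM2l// ler_wpM2l.
  have s2 : (1 + eta) * ((1 - eta) * (pi ^+ 2 * U)) <= (1 + eta) * ((1 - eta) * V).
    by rewrite !ler_pM2l.
  have s3 : (1 + eta) * ((1 - eta) * V) <= (1 + eta) * Y by rewrite ler_pM2l.
  apply: le_trans s1 _; apply: le_trans (le_trans s2 s3).
  by rewrite le_eqVlt; apply/orP; left; apply/eqP; ring.
apply/ler_addgt0Pr => e e0.
have Y0 : 0 <= Y.
  apply: Rintegral_ge0 => x; rewrite /= in_itv /= => /in01 /h0 hx.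
  by rewrite divr_ge0 ?sqr_ge0// ltW.
have X0 : 0 <= pi ^+ 2 * X.
  rewrite mulr_ge0 ?sqr_ge0//; apply: Rintegral_ge0 => x.
  by rewrite /= in_itv /= => /in01 /h0 hx; rewrite divr_ge0 ?sqr_ge0// ltW.
pose eta := Num.min 2^-1 (e / (pi ^+ 2 * X + Y + 1)).
have Z0 : 0 < pi ^+ 2 * X + Y + 1 by lra.
have eta0 : 0 < eta by rewrite lt_min divr_gt0// invr_gt0 ltr0n.
have eta1 : eta <= 2^-1 by rewrite ge_min lexx.
have etae : eta * (pi ^+ 2 * X + Y + 1) <= e.
  by rewrite -ler_pdivlMr// ge_min lexx orbT.
have := main eta; move: (pi ^+ 2 * X) X0 Z0 etae => W W0 Z0 etae.
have -> : 0 < eta < 1 by lra.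
by move=> /(_ isT); lra.
Qed.

End PayneWeinberger.

(** * Second moment of a concave function *)

Section Variance.
Context {R : realType}.
Implicit Types f g u v h k : R -> R.
Local Notation mu := (@lebesgue_measure R).

(** Its square is continuously differentiable, which makes explicit
    antiderivatives of functions with a kink available. *)
Definition pospart (t : R) : R := Num.max 0 t.

Lemma pospart_continuous : continuous pospart.
Proof.
move=> t; apply: (@continuous_max _ _ (cst 0) id); first exact: cvg_cst.
exact: cvg_id.
Qed.

Lemma pospart_pos t : 0 <= t -> pospart t = t.
Proof. exact: max_r. Qed.

Lemma pospart_neg t : t <= 0 -> pospart t = 0.
Proof. exact: max_l. Qed.

(** At 0 the difference quotient of the square is the positive part itself. *)
Lemma is_derive_sqr_pospart (t : R) :
  is_derive t 1 (fun y => pospart y ^+ 2) (2 * pospart t).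
Proof.
have [t0|t0|->] := ltgtP t 0.
- rewrite /pospart max_l ?ltW// mulr0.
  have d0 : is_derive t 1 (fun _ : R => 0 : R) 0 by exact: is_derive_cst.
  apply: near_eq_is_derive d0.
  near=> y; rewrite /= max_l ?expr0n//.
  by near: y; exact: lt_le_nbhsl.
- rewrite /pospart max_r ?ltW//.
  have d2 : is_derive t 1 (fun y : R => y ^+ 2) (2 * t).
    by apply: is_derive_eq; rewrite /GRing.scale /=; ring.
  apply: near_eq_is_derive d2.
  near=> y; rewrite /= max_r//.
  by apply/ltW; near: y; exact: lt_nbhsr.
- apply/is_derive1_caratheodory; exists pospart; split.
  + move=> z; rewrite /pospart maxxx expr0n !subr0 /Num.max; case: ifP => // _.
    by rewrite expr0n mul0r.
  + exact: pospart_continuous.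
  + by rewrite /pospart maxxx mulr0.
Unshelve. all: by end_near. Qed.

Context (h : R -> R).
Context (h_ge0 : forall x, 0 < x < 1 -> 0 <= h x) (h_concave : concave_on01 h).
Context (h_neq0 : exists2 x, I01 x & h x != 0).

Let h_gt0 := concave_gt0 h_ge0 h_concave h_neq0.

Let measurable_h : measurable_fun (I01 : set R) h.
Proof. by apply: continuous_measurable01 => x x01; exact: concave_continuous. Qed.

Lemma concave_integrable01 : integrable01 h.
Proof.
apply: (@bounded_integrable01 _ _ (2 * h 2^-1)) => // x x01.
by rewrite ger0_norm ?h_ge0// concave_le_mid.
Qed.

Lemma integrable01_mul_concave f : continuous f -> integrable01 (fun x => f x * h x).
Proof.
move=> cf; have fi := continuous_integrable01 cf.
have mf : measurable_fun (I01 : set R) f by exact: measurable_integrable01.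
have ai : integrable01 (fun x => `|f x|).
  by apply: continuous_integrable01 => x; apply: continuous_comp; [exact: cf|exact: norm_continuous].
apply: le_integrable01 (integrable01Z (2 * h 2^-1) ai).
  exact: measurable_funM.
move=> x x01; rewrite normrM mulrC ler_wpM2r//.
by rewrite ger0_norm ?h_ge0// concave_le_mid.
Qed.

(** The slope is the supremum of the slopes of the chords to the right of c, which
    are bounded by the slopes of the chords to the left. *)
Lemma supporting_line (c : R) : 0 < c < 1 ->
  exists kappa, forall x, 0 < x < 1 -> h x <= h c + kappa * (x - c).
Proof.
move=> /andP[c0 c1].
pose E := [set s | exists2 x, c < x < 1 & s = (h x - h c) / (x - c)].
have slope y : 0 < y < c -> ubound E ((h c - h y) / (c - y)).
  move=> /andP[y0 yc] _ [x /andP[cx x1] ->].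
  have := concave_three_points h_concave y0 yc cx x1.
  rewrite ler_pdivrMr ?subr_gt0// mulrAC ler_pdivlMr ?subr_gt0//.
  by move: (h x) (h c) (h y) => hx hc hy; nra.
have E0 : E !=set0.
  by exists ((h ((c + 1) / 2) - h c) / ((c + 1) / 2 - c)), ((c + 1) / 2) => //; lra.
have Eub : has_ubound E.
  by exists ((h c - h (c / 2)) / (c - c / 2)); apply: slope; lra.
exists (sup E) => x /andP[x0 x1]; have [xc|cx|->] := ltgtP x c; last 1 first.
- by rewrite subrr mulr0 addr0.
- have cx0 : 0 < c - x by lra.
  have : sup E <= (h c - h x) / (c - x) by apply: ge_sup => //; apply: slope; lra.
  by rewrite ler_pdivlMr//; lra.
- have xc0 : 0 < x - c by lra.
  have : (h x - h c) / (x - c) <= sup E.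
    by apply: ub_le_sup => //; exists x => //; rewrite cx x1.
  by rewrite ler_pdivrMr//; lra.
Qed.

Lemma is_derive_sqr_pospart_comp (f : R -> R) (x df : R) : is_derive x 1 f df ->
  is_derive x 1 (fun y => pospart (f y) ^+ 2) (2 * pospart (f x) * df).
Proof. by move=> dfx; exact: (is_derive1_comp (is_derive_sqr_pospart (f x)) dfx). Qed.

(** With z = x - c, the tent T of height h(c) and peak at c, and a supporting line
    l at c, the inequality is the integral of
      (rho - z^2) h <= (rho - z^2) T + max (0, rho - z^2) (l - T).
    This holds pointwise, because h lies between T and l.  The function l - T is
    al z to the right of c and be |z| to the left, with al + be = h(c) / (c (1 - c))
    whatever the slope of l, and the last term has integral at most
    (al + be) rho^2 / 4. *)
Lemma second_moment_ge (c rho : R) : 0 < c < 1 -> 0 <= rho ->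
  rho * integral01 h - integral01 (fun x => (x - c) ^+ 2 * h x) <=
  h c * (rho / 2 - (1 - 3 * (c * (1 - c))) / 12) + h c / (c * (1 - c)) * (rho ^+ 2 / 4).
Proof.
move=> /andP[c0 c1] rho0; have [kappa hk] := @supporting_line c (ltac:(by rewrite c0 c1)).
pose H := h c.
have H0 : 0 < H by apply: h_gt0; rewrite c0 c1.
pose al := kappa + H / (1 - c); pose be := H / c - kappa.
pose zp x := pospart (x - c); pose zn x := pospart (c - x).
pose sp x := zp x ^+ 2; pose sn x := zn x ^+ 2.
pose php x := pospart (rho - sp x); pose phn x := pospart (rho - sn x).
pose G x := H * ((rho - (x - c) ^+ 2) - (rho - sp x) * zp x / (1 - c)
     - (rho - sn x) * zn x / c) + al * (php x * zp x) + be * (phn x * zn x).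
(* An antiderivative of G.  Since the derivatives of sp and sn are 2 zp and
   -2 zn, all terms with a kink are polynomials in sp, sn and the squares of
   php and phn. *)
pose W x := H * ((rho * (x - c) - (x - c) ^+ 3 / 3)
     - (rho * sp x / 2 - sp x ^+ 2 / 4) / (1 - c)
     + (rho * sn x / 2 - sn x ^+ 2 / 4) / c)
     - al * php x ^+ 2 / 4 + be * phn x ^+ 2 / 4.
have dzp (x : R) : is_derive x 1 (fun y : R => y - c) 1.
  by apply: is_derive_eq; ring.
have dzn (x : R) : is_derive x 1 (fun y : R => c - y) (-1).
  by apply: is_derive_eq; ring.
have dsp (x : R) : is_derive x 1 sp (2 * zp x).
  by rewrite -[2 * _]mulr1; exact: is_derive_sqr_pospart_comp.
have dsn (x : R) : is_derive x 1 sn (2 * zn x * -1).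
  exact: is_derive_sqr_pospart_comp.
have dphp (x : R) : is_derive x 1 (fun y => php y ^+ 2) (2 * php x * - (2 * zp x)).
  by apply: is_derive_sqr_pospart_comp; apply: is_derive_eq; ring.
have dphn (x : R) : is_derive x 1 (fun y => phn y ^+ 2) (2 * phn x * (2 * zn x)).
  by apply: is_derive_sqr_pospart_comp; apply: is_derive_eq; ring.
have dW (x : R) : is_derive x 1 W (G x).
  by apply: is_derive_eq; rewrite /G /GRing.scale /=; field; lra.
have cz (x : R) : {for x, continuous (fun y : R => y - c)} := is_derive_continuous (dzp x).
have cpos f (x : R) : {for x, continuous f} -> {for x, continuous (fun y => pospart (f y))}.
  by move=> cf; apply: continuous_comp => //; exact: pospart_continuous.
have czp (x : R) : {for x, continuous zp} by apply: cpos; exact: cz.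
have czn (x : R) : {for x, continuous zn}.
  by apply: cpos; exact: is_derive_continuous (dzn x).
have csp (x : R) : {for x, continuous sp} := is_derive_continuous (dsp x).
have csn (x : R) : {for x, continuous sn} := is_derive_continuous (dsn x).
have cr f (x : R) : {for x, continuous f} -> {for x, continuous (fun y => rho - f y)}.
  by move=> cf; apply: cvgB; [exact: cvg_cst|exact: cf].
have cM f g (x : R) : {for x, continuous f} -> {for x, continuous g} ->
    {for x, continuous (fun y => f y * g y)}.
  by move=> cf cg; apply: cvgM; [exact: cf|exact: cg].
have cD f g (x : R) : {for x, continuous f} -> {for x, continuous g} ->
    {for x, continuous (fun y => f y + g y)}.
  by move=> cf cg; apply: cvgD; [exact: cf|exact: cg].
have cB f g (x : R) : {for x, continuous f} -> {for x, continuous g} ->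
    {for x, continuous (fun y => f y - g y)}.
  by move=> cf cg; apply: cvgB; [exact: cf|exact: cg].
have ck (k x : R) : {for x, continuous (fun _ : R => k)} by exact: cvg_cst.
have cphp (x : R) : {for x, continuous php} by apply: cpos; exact: cr.
have cphn (x : R) : {for x, continuous phn} by apply: cpos; exact: cr.
have cz2 (x : R) : {for x, continuous (fun y : R => (y - c) ^+ 2)}.
  exact: (cM _ _ _ (cz x) (cz x)).
have cG : continuous G.
  move=> x.
  have t1 := cM _ _ _ (ck al x) (cM _ _ _ (cphp x) (czp x)).
  have t2 := cM _ _ _ (ck be x) (cM _ _ _ (cphn x) (czn x)).
  have t3 := cM _ _ _ (cM _ _ _ (cr _ _ (csp x)) (czp x)) (ck (1 - c)^-1 x).
  have t4 := cM _ _ _ (cM _ _ _ (cr _ _ (csn x)) (czn x)) (ck c^-1 x).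
  have t5 := cM _ _ _ (ck H x) (cB _ _ _ (cB _ _ _ (cr _ _ (cz2 x)) t3) t4).
  exact: (cD _ _ _ (cD _ _ _ t5 t1) t2).
have al0 : 0 <= al.
  have m1 : (c + 1) / 2 < 1 by lra.
  have m0 : c < (c + 1) / 2 by lra.
  have := concave_div_ge h_concave h_ge0 c0 m0 m1.
  have := hk ((c + 1) / 2) (ltac:(apply/andP; split; lra)).
  have cc : 0 < 1 - c by lra.
  have e : al * (1 - c) = kappa * (1 - c) + H by rewrite /al; field; lra.
  rewrite -(@pmulr_lge0 _ (1 - c) al cc) e -/H.
  by move: (h ((c + 1) / 2)) => hm; nra.
have be0 : 0 <= be.
  have m1 : c / 2 < c by lra.
  have m0 : 0 < c / 2 by lra.
  have := concave_div_le h_concave h_ge0 m0 m1 c1.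
  have := hk (c / 2) (ltac:(apply/andP; split; lra)).
  have e : be * c = H - kappa * c by rewrite /be; field; lra.
  rewrite -(@pmulr_lge0 _ c be c0) e -/H.
  by move: (h (c / 2)) => hm; nra.
have iG := continuous_integrable01 cG.
have ih := concave_integrable01.
have iV : integrable01 (fun x => (x - c) ^+ 2 * h x).
  by apply: integrable01_mul_concave => x; exact: cz2.
have GE : integral01 G = W 1 - W 0 by exact: FTC01.
have le1 : rho * integral01 h - integral01 (fun x => (x - c) ^+ 2 * h x) <= integral01 G.
  have iR := integrable01Z rho ih.
  rewrite -(integral01Z _ ih) -(integral01B iR iV).
  apply: le_integral01 => //; first exact: integrable01B.
  move=> x x01; have /andP[x0 x1] := x01; have hx := hk x x01.
  rewrite -mulrBl /G.
  have [cx|xc] := leP c x.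
    have -> : zn x = 0 by apply: pospart_neg; lra.
    have -> : zp x = x - c by apply: pospart_pos; lra.
    have -> : sp x = (x - c) ^+ 2 by rewrite /sp /zp pospart_pos//; lra.
    have T1 : H * (1 - (x - c) / (1 - c)) <= h x.
      have -> : 1 - (x - c) / (1 - c) = (1 - x) / (1 - c) by field; lra.
      rewrite mulrA ler_pdivrMr ?subr_gt0//.
      move: cx; rewrite le_eqVlt => /orP[/eqP <-//|cx].
      exact: concave_div_ge.
    have T2 : h x <= H * (1 - (x - c) / (1 - c)) + al * (x - c).
      apply: (le_trans hx); rewrite le_eqVlt; apply/orP; left; apply/eqP.
      by rewrite /al /H; field; lra.
    have -> : H * (rho - (x - c) ^+ 2 - (rho - (x - c) ^+ 2) * (x - c) / (1 - c)
        - (rho - sn x) * 0 / c) + al * (php x * (x - c)) + be * (phn x * 0) =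
        (rho - (x - c) ^+ 2) * (H * (1 - (x - c) / (1 - c))) + php x * (al * (x - c)).
      by ring.
    rewrite /php /sp /zp (@pospart_pos (x - c)) ?subr_ge0//.
    have [s0|s0] := leP 0 (rho - (x - c) ^+ 2).
      by rewrite pospart_pos// -mulrDr ler_wpM2l.
    by rewrite (pospart_neg (ltW s0)) mul0r addr0 ler_wnM2l// ltW.
  have -> : zp x = 0 by apply: pospart_neg; lra.
  have -> : zn x = c - x by apply: pospart_pos; lra.
  have -> : sn x = (x - c) ^+ 2.
    by rewrite /sn /zn pospart_pos; [rewrite -sqrrN opprB|lra].
  have T1 : H * (1 - (c - x) / c) <= h x.
    have -> : 1 - (c - x) / c = x / c by field; lra.
    by rewrite mulrA ler_pdivrMr//; exact: concave_div_le.
  have T2 : h x <= H * (1 - (c - x) / c) + be * (c - x).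
    apply: (le_trans hx); rewrite le_eqVlt; apply/orP; left; apply/eqP.
    by rewrite /be /H; field; lra.
  have -> : H * (rho - (x - c) ^+ 2 - (rho - sp x) * 0 / (1 - c)
      - (rho - (x - c) ^+ 2) * (c - x) / c) + al * (php x * 0) + be * (phn x * (c - x)) =
      (rho - (x - c) ^+ 2) * (H * (1 - (c - x) / c)) + phn x * (be * (c - x)).
    by ring.
  have cx0 : 0 <= c - x by lra.
  rewrite /phn /sn /zn (pospart_pos cx0).
  rewrite -[(c - x) ^+ 2]sqrrN opprB.
  have [s0|s0] := leP 0 (rho - (x - c) ^+ 2).
    by rewrite pospart_pos// -mulrDr ler_wpM2l.
  by rewrite (pospart_neg (ltW s0)) mul0r addr0 ler_wnM2l// ltW.
apply: le_trans le1 _; rewrite GE /W.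
have z1 : zp 1 = 1 - c by apply: pospart_pos; lra.
have z2 : zn 1 = 0 by apply: pospart_neg; lra.
have z3 : zp 0 = 0 by apply: pospart_neg; lra.
have z4 : zn 0 = c by rewrite /zn subr0; apply: pospart_pos; lra.
have p1 : phn 1 = rho by rewrite /phn /sn z2 expr0n subr0 pospart_pos.
have p2 : php 0 = rho by rewrite /php /sp z3 expr0n subr0 pospart_pos.
rewrite p1 p2 /sp /sn z1 z2 z3 z4.
have q1 := mulr_ge0 al0 (sqr_ge0 (php 1)).
have q2 := mulr_ge0 be0 (sqr_ge0 (phn 0)).
rewrite -subr_ge0 -/H.
(* The difference of the two sides comes from the parts of the interval
   |z|^2 < rho that lie outside (0,1). *)
rewrite (_ : _ - _ = (al * php 1 ^+ 2 + be * phn 0 ^+ 2) / 4); first by rewrite divr_ge0// addr_ge0.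
by rewrite /al /be; field; lra.
Qed.

(** The line through (c, h(c)) and (1, 0) lies below h to the right of c and above
    it to the left, so (x - c) (h - line) >= 0.  Integration gives c >= 1/3; the
    line through (0, 0) and (c, h(c)) gives c <= 2/3. *)
Lemma mean_mem_third (c : R) : 0 < c < 1 -> integral01 (fun x => (x - c) * h x) = 0 ->
  3^-1 <= c <= 2 / 3.
Proof.
move=> /andP[c0 c1] mean0.
have hc0 : 0 < h c by apply: h_gt0; rewrite c0 c1.
have cx : continuous (fun x : R => x - c).
  by move=> x; apply: cvgB; [exact: cvg_id|exact: cvg_cst].
have im := integrable01_mul_concave cx.
have d1 (x : R) : is_derive x 1 (fun y : R => h c * ((y - c) ^+ 2 / 2 * (1 - c) - (y - c) ^+ 3 / 3))
    (h c * ((x - c) * (1 - x))).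
  by apply: is_derive_eq; rewrite /GRing.scale /=; field.
have d2 (x : R) : is_derive x 1 (fun y : R => h c * ((y - c) ^+ 2 / 2 * c + (y - c) ^+ 3 / 3))
    (h c * ((x - c) * x)).
  by apply: is_derive_eq; rewrite /GRing.scale /=; field.
have cont1 : continuous (fun x : R => h c * ((x - c) * (1 - x))).
  move=> x; apply: cvgM; first exact: cvg_cst.
  by apply: cvgM; [exact: cx|apply: cvgB; [exact: cvg_cst|exact: cvg_id]].
have cont2 : continuous (fun x : R => h c * ((x - c) * x)).
  move=> x; apply: cvgM; first exact: cvg_cst.
  by apply: cvgM; [exact: cx|exact: cvg_id].
have F1 := FTC01 cont1 d1; have F2 := FTC01 cont2 d2.
have le1 : integral01 (fun x => h c * ((x - c) * (1 - x))) <= (1 - c) * 0.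
  rewrite -mean0 -integral01Z//; apply: le_integral01.
  - exact: continuous_integrable01.
  - exact: integrable01Z.
  - move=> x /andP[x0 x1]; have [xc|xc|->] := ltgtP x c; last by rewrite subrr !(mul0r, mulr0).
    + have := concave_div_ge h_concave h_ge0 x0 xc c1.
      by move: (h x) (h c) => hx hc; nra.
    + have := concave_div_ge h_concave h_ge0 c0 xc x1.
      by move: (h x) (h c) => hx hc; nra.
have le2 : c * 0 <= integral01 (fun x => h c * ((x - c) * x)).
  rewrite -mean0 -integral01Z//; apply: le_integral01.
  - exact: integrable01Z.
  - exact: continuous_integrable01.
  - move=> x /andP[x0 x1]; have [xc|xc|->] := ltgtP x c; last by rewrite subrr !(mul0r, mulr0).
    + have := concave_div_le h_concave h_ge0 x0 xc c1.
      by move: (h x) (h c) => hx hc; nra.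
    + have := concave_div_le h_concave h_ge0 c0 xc x1.
      by move: (h x) (h c) => hx hc; nra.
rewrite mulr0 F1 -mulrBr pmulr_rle0// in le1.
rewrite mulr0 F2 -mulrBr pmulr_rge0// in le2.
by apply/andP; split; [move: le1|move: le2]; lra.
Qed.

(** The bound of [second_moment_ge] is optimized in rho, which gives
      V >= h(c) (1 - 3 q) / 12 + q (A - h(c) / 2)^2 / h(c);
    the claim then differs from this by a perfect square. *)
Lemma sqr_integral_le_second_moment (c : R) : 3^-1 <= c <= 2 / 3 ->
  integral01 h ^+ 2 * ((c * (1 - c)) * (1 - 3 * (c * (1 - c)))) <=
  h c * integral01 (fun x => (x - c) ^+ 2 * h x).
Proof.
move=> /andP[c13 c23]; have c01 : 0 < c < 1 by lra.
have H0 : 0 < h c by exact: h_gt0.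
have q0 : 0 < c * (1 - c) by rewrite mulr_gt0//; lra.
have q4 : c * (1 - c) <= 4^-1 by have := sqr_ge0 (c - 2^-1); lra.
have key rho := @second_moment_ge c rho c01.
move: (h c) H0 key => H H0.
move: (c * (1 - c)) q0 q4 => q q0 q4.
set V := integral01 (fun x => (x - c) ^+ 2 * h x).
set A := integral01 h => key.
have A0 : 0 <= A by apply: integral01_ge0.
have [AH|AH] := leP A (H / 2).
  have := key 0 (lexx 0); rewrite !mul0r expr0n /= !mul0r mulr0 addr0 !sub0r => k0.
  have VH : H * ((1 - 3 * q) / 12) <= V by lra.
  have e1 : A ^+ 2 <= H ^+ 2 / 4.
    by rewrite (_ : H ^+ 2 / 4 = (H / 2) ^+ 2); [rewrite ler_sqr ?nnegrE//; lra|field].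
  have m0 : 0 <= q * (1 - 3 * q) by rewrite mulr_ge0//; lra.
  have e2 : A ^+ 2 * (q * (1 - 3 * q)) <= H ^+ 2 / 4 * (q * (1 - 3 * q)).
    by rewrite ler_wpM2r.
  have e3 : H * (H * ((1 - 3 * q) / 12)) <= H * V by rewrite ler_pM2l.
  have e4 : 0 <= H ^+ 2 * (1 - 3 * q) * (3^-1 - q).
    by rewrite !mulr_ge0 ?sqr_ge0//; lra.
  by nra.
have K0 : 0 <= A - H / 2 by lra.
(* This rho maximizes the lower bound for V when A >= H / 2; otherwise rho = 0
   is the best choice. *)
have rho0 : 0 <= 2 * q * (A - H / 2) / H by rewrite divr_ge0 ?mulr_ge0//; lra.
have k1 := key _ rho0.
have k2 : H * (2 * q * (A - H / 2) / H * A - V) <=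
  H * (H * (2 * q * (A - H / 2) / H / 2 - (1 - 3 * q) / 12) +
       H / q * ((2 * q * (A - H / 2) / H) ^+ 2 / 4)) by rewrite ler_pM2l.
have e1 : H * (2 * q * (A - H / 2) / H * A - V) = 2 * q * (A - H / 2) * A - H * V.
  by field; rewrite gt_eqF.
have e2 : H * (H * (2 * q * (A - H / 2) / H / 2 - (1 - 3 * q) / 12) +
       H / q * ((2 * q * (A - H / 2) / H) ^+ 2 / 4)) =
  H * (q * (A - H / 2)) - H ^+ 2 * (1 - 3 * q) / 12 + q * (A - H / 2) ^+ 2.
  by field; rewrite !gt_eqF.
rewrite e1 e2 in k2.
have := sqr_ge0 (q * (A - H / 2) - (1 - 3 * q) * H / 6).
by lra.
Qed.

End Variance.

(** * Bounds for the two eigenvalues *)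

Section Eigenvalues.
Context {R : realType}.
Context (h : R -> R).
Context (h_ge0 : forall x, 0 < x < 1 -> 0 <= h x) (h_concave : concave_on01 h).
Context (h_neq0 : exists2 x, I01 x & h x != 0).

Let h_gt0 := concave_gt0 h_ge0 h_concave h_neq0.
Let h_cont := concave_continuous h_ge0 h_concave h_neq0.
Let M : R := Num.max (2 * h 2^-1) 1.

Let h_bound x : 0 < x < 1 -> 0 < h x <= M.
Proof. by move=> x01; rewrite h_gt0// le_max concave_le_mid. Qed.

Let integrable_h : integrable01 h := concave_integrable01 h_ge0 h_concave h_neq0.

Lemma integral01_concave_gt0 : 0 < integral01 h.
Proof. exact: integral01_pos. Qed.

Lemma center_of_mass : exists2 c, 3^-1 <= c <= 2 / 3 &
  integral01 (fun x => (x - c) * h x) = 0.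
Proof.
have A0 := integral01_concave_gt0.
have ix : integrable01 (fun x => x * h x).
  by apply: integrable01_mul_concave => // x; exact: cvg_id.
pose c := integral01 (fun x => x * h x) / integral01 h.
have c0 : 0 < c.
  rewrite divr_gt0// integral01_pos// => x x01.
  by rewrite mulr_gt0 ?h_gt0//; case/andP: x01.
have c1 : c < 1.
  rewrite ltr_pdivrMr// mul1r -subr_gt0 -integral01B//.
  apply: integral01_pos => [|x x01]; first exact: integrable01B.
  have hx := h_gt0 x01; have /andP[x0 x1] := x01; nra.
have m0 : integral01 (fun x => (x - c) * h x) = 0.
  transitivity (integral01 (fun x => x * h x - c * h x)).
    by apply: eq_integral01 => x _; rewrite mulrBl.
  rewrite integral01B//; last exact: integrable01Z.
  by rewrite integral01Z// /c divfK ?subrr// gt_eqF.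
by exists c => //; apply: (mean_mem_third h_ge0 h_concave h_neq0) => //; rewrite c0 c1.
Qed.

Lemma mu1_ge_pi2 : pi ^+ 2 <= mu1 h.
Proof.
have [c _ mean0] := center_of_mass.
apply: (@rayleigh_inf_ge _ h h _ M c) => //.
  by apply: continuous_measurable01 => x; exact: h_cont.
move=> u du uH u0; apply: (@poincare_of_hardy _ h h M) => //.
- by rewrite exprn_gt0// pi_gt0.
- exact: hardy_concave.
Qed.

Lemma mu1_le_variance c : integral01 (fun x => (x - c) * h x) = 0 ->
  mu1 h <= integral01 h / integral01 (fun x => (x - c) ^+ 2 * h x).
Proof. by move=> mean0; apply: rayleigh_inf_le => //; exact: h_ge0. Qed.

Lemma integral01_centered : integral01 (fun x : R => (x - 2^-1) * 1) = 0.
Proof.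
have cf : continuous (fun x : R => (x - 2^-1) * 1).
  move=> x; apply: cvgM; last exact: cvg_cst.
  by apply: cvgB; [exact: cvg_id|exact: cvg_cst].
have df (x : R) : is_derive x 1 (fun y : R => (y - 2^-1) ^+ 2 / 2) ((x - 2^-1) * 1).
  by apply: is_derive_eq; rewrite /GRing.scale /=; field.
by rewrite (FTC01 cf df); field.
Qed.

Lemma sigma1_le_integral : sigma1 h <= 12 * integral01 h.
Proof.
rewrite sigma1E; have := @rayleigh_inf_le _ h (fun=> 1) 2^-1 h_ge0 _ integral01_centered.
rewrite (_ : integral01 (fun x => (x - 2^-1) ^+ 2 * 1) = 12^-1); last first.
  transitivity (integral01 (fun x : R => (x - 2^-1) ^+ 2)).
    by apply: eq_integral01 => x _; rewrite mulr1.
  by rewrite integral01_sqr_affine; field.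
by rewrite invrK mulrC; apply=> x _; exact: ler01.
Qed.

Lemma sigma1_ge (c : R) : 3^-1 <= c <= 2 / 3 ->
  h c / (4 * (c * (1 - c)) * (1 - 3 * (c * (1 - c)))) <= sigma1 h.
Proof.
move=> c13; rewrite sigma1E.
have one_bound (x : R) : 0 < x < 1 -> 0 < (1 : R) <= M by rewrite ltr01 le_max lexx orbT.
have one_cont (x : R) : 0 < x < 1 -> {for x, continuous (fun _ : R => 1 : R)}.
  by move=> _; exact: cvg_cst.
apply: (@rayleigh_inf_ge _ h (fun=> 1) _ M 2^-1) => //.
  exact: integral01_centered.
move=> u du uH u0; apply: (@poincare_of_hardy _ h (fun=> 1) M) => //.
- have /andP[c1 c2] := c13.
  have q4 : c * (1 - c) <= 4^-1 by have := sqr_ge0 (c - 2^-1); lra.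
  rewrite divr_gt0 ?h_gt0 ?mulr_gt0//; lra.
- exact: hardy_tent.
Qed.

End Eigenvalues.

Theorem theorem1p2 (R : realType) (h : R -> R)
    (h_bounded : L_on01 +oo%E h)
    (h_ge0 : forall x, I01 x -> 0 <= h x)
    (h_concave : concave_on01 h)
    (h_neq0 : exists2 x, I01 x & h x != 0) :
  pi ^+ 2 / 12 <= F h <= 4.
Proof.
have h0 x : 0 < x < 1 -> 0 <= h x by move=> /in_I01; exact: h_ge0.
have A0 := integral01_concave_gt0 h0 h_concave h_neq0.
have [c c13 mean0] := center_of_mass h0 h_concave h_neq0.
have c01 : 0 < c < 1 by move: c13 => /andP[? ?]; apply/andP; split; lra.
have hc := concave_gt0 h0 h_concave h_neq0 c01.
have mu_lo := mu1_ge_pi2 h0 h_concave h_neq0.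
have mu_hi := mu1_le_variance h0 mean0.
have sg_hi := sigma1_le_integral h0.
have sg_lo := sigma1_ge h0 h_concave h_neq0 c13.
have AV := sqr_integral_le_second_moment h0 h_concave h_neq0 c13.
rewrite /F; move: (h c) hc sg_lo AV => H H0 sg_lo AV.
move: (mu1 h) (sigma1 h) mu_lo mu_hi sg_hi sg_lo => m s mu_lo mu_hi sg_hi sg_lo.
move: (integral01 h) (integral01 (fun x => (x - c) ^+ 2 * h x)) A0 AV mu_hi sg_hi.
move=> A V A0 AV mu_hi sg_hi.
have q0 : 0 < c * (1 - c) by move: c01 => /andP[? ?]; rewrite mulr_gt0//; lra.
have q4 : c * (1 - c) <= 4^-1 by have := sqr_ge0 (c - 2^-1); lra.
move: (c * (1 - c)) q0 q4 AV sg_lo => q q0 q4 AV sg_lo.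
have m0 : 0 < 1 - 3 * q by lra.
have s0 : 0 < s by apply: lt_le_trans sg_lo; rewrite divr_gt0// mulr_gt0// mulr_gt0.
have V0 : 0 < V.
  rewrite -(pmulr_rgt0 _ H0); apply: lt_le_trans AV.
  by rewrite mulr_gt0 ?exprn_gt0// mulr_gt0.
apply/andP; split.
  rewrite ler_pdivlMr//; apply: (@le_trans _ _ (pi ^+ 2 / 12 * (12 * A))).
    by rewrite ler_wpM2l// divr_ge0 ?sqr_ge0.
  rewrite mulrA divfK ?pnatr_eq0// ler_wpM2r// ltW//.
rewrite ler_pdivrMr//.
apply: (@le_trans _ _ (A / V * A)); first by rewrite ler_wpM2r// ltW.
apply: (@le_trans _ _ (4 * (H / (4 * q * (1 - 3 * q))))); last by rewrite ler_pM2l.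
have -> : 4 * (H / (4 * q * (1 - 3 * q))) = H / (q * (1 - 3 * q)) by field; rewrite !gt_eqF.
by rewrite mulrAC -expr2 ler_pdivrMr// mulrAC ler_pdivlMr// mulr_gt0.
Qed.
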